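(* Consider the mass migration generator $\mathcal L$ and assume that there exists a constant $C>0$ such that $$\sum_{k=1}^{\alpha\vee\gamma}k\,|g^k_{\alpha,\beta}-g^k_{\gamma,\delta}|\le C(|\alpha-\gamma|+|\beta-\delta|)\qquad\text{for all }\alpha,\beta,\gamma,\delta\ge0.$$ Then there exist a Markov semigroup of operators $(S(t),t\ge0)$, defined on the Lipschitz functions $\mathbf L$ on $\mathfrak X$, and a constant $c>0$ such that for all $f\in\mathbf L$, $t\ge0$, $\eta\in\mathfrak X$: (1) $S(t)f\in\mathbf L$ and $L_{S(t)f}\le L_fe^{ct}$; (2) $S(t)f(\eta)=f(\eta)+\int_0^t\mathcal LS(s)f(\eta)\,ds$; (3) if $\sum_{x\in X}\eta(x)<+\infty$, then $S(t)f(\eta)=\mathbb E^\eta f(\eta_t)$, where $(\eta_t)_{t\ge0}$ is the (countable state space) Markov process in which $k$ particles jump together from $x$ to $y$ at rate $p(x,y)g^k_{\eta(x),\eta(y)}$, with initial configuration $\eta_0=\eta$, and $\mathbb E^\eta$ denotes its expectation.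
   Context: $\mathbb N=\{0,1,2,\dots\}$; $X$ is a countably infinite set of sites. $(p(x,y))_{x,y\in X}$ is an irreducible transition probability with $\sup_{y}\sum_xp(x,y)=m_p<\infty$. The rates are numbers $g^k_{\alpha,\beta}\ge0$ ($k,\alpha,\beta\in\mathbb N$) with $g^0_{\alpha,\beta}=0$ and $g^k_{\alpha,\beta}=0$ if $k>\alpha$ or $\alpha=0$. Fix a positive function $a$ on $X$ and $M>0$ with $\sum_yp(x,y)a_y+\sum_ya_yp(y,x)\le Ma_x$ for all $x\in X$, and $\sum_xa_x<\infty$. Set $\|\eta\|=\sum_x\eta(x)a_x$, $\|\eta-\zeta\|=\sum_x|\eta(x)-\zeta(x)|a_x$, $\mathfrak X=\{\eta\in\mathbb N^X:\|\eta\|<\infty\}$. $\mathbf L$ is the set of $f:\mathfrak X\to\mathbb R$ such that for some $L_f>0$, $|f(\eta)-f(\zeta)|\le L_f\|\eta-\zeta\|$ for all $\eta,\zeta\in\mathfrak X$; $L_f$ denotes such a Lipschitz constant. Generator: $\mathcal Lf(\eta)=\sum_{x,y\in X}\sum_{k>0}p(x,y)g^k_{\eta(x),\eta(y)}\big(f(\mathcal S^k_{x,y}\eta)-f(\eta)\big)$ for $f\in\mathbf L,\eta\in\mathfrak X$, where $\mathcal S^k_{x,y}\eta$ is $\eta$ with $k$ particles moved from $x$ to $y$ if $\eta(x)\ge k$ and $x\ne y$, and $\mathcal S^k_{x,y}\eta=\eta$ otherwise. *)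

(* Defs.v *)
From HB Require Import structures.
From mathcomp Require Import all_boot all_order all_algebra.
From mathcomp Require Import all_classical all_reals all_analysis.
Import Order.TTheory GRing.Theory Num.Theory.
Import numFieldNormedType.Exports.

Set Implicit Arguments.
Unset Strict Implicit.
Unset Printing Implicit Defensive.

Local Open Scope classical_set_scope.
Local Open Scope ring_scope.

(* Sum of a real family indexed by D. [\esum] is only meaningful for nonnegative
   terms, hence the splitting; the value is relevant only if the family is
   absolutely summable. *)
Definition rsum (R : realType) (T : choiceType) (D : set T) (f : T -> R) : R :=
  fine (\esum_(i in D) (EFin \o f)^\+ i - \esum_(i in D) (EFin \o f)^\- i)%E.

Section transition_probability.
Context {R : realType} {X : countType}.
Implicit Types p : X -> X -> R.

Definition transition_probability p :=
  (forall x y, 0 <= p x y) /\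
  (forall x, \esum_(y in setT) (p x y)%:E = 1%E).

Fixpoint nstep p (n : nat) (x y : X) : \bar R :=
  if n is m.+1 then (\esum_(z in setT) ((p x z)%:E * nstep p m z y))%E
  else ((x == y)%:R)%:E.

Definition irreducible p := forall x y, exists n, (0 < nstep p n x y)%E.

End transition_probability.

Section configurations.
Context {R : realType} {X : countType}.
Variable a : X -> {posnum R}.

Definition cnorm (eta : X -> nat) : \bar R :=
  (\esum_(x in setT) ((eta x)%:R * (a x)%:num)%:E)%E.

Definition config := set_type [set eta : X -> nat | (cnorm eta < +oo)%E].

Definition cdist (eta zeta : config) : \bar R :=
  (\esum_(x in setT)
     (`|(val eta x)%:R - (val zeta x)%:R| * (a x)%:num)%:E)%E.

Definition lipschitz_constant (f : config -> R) (L : R) :=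
  0 < L /\ forall eta zeta,
    (`|f eta - f zeta|%:E <= L%:E * cdist eta zeta)%E.

Definition LL : set (config -> R) :=
  [set f | exists L, lipschitz_constant f L].

Definition move_fun (k : nat) (x y : X) (eta : X -> nat) : X -> nat :=
  if (k <= eta x)%N && (x != y) then
    fun z => if z == x then (eta z - k)%N
             else if z == y then (eta z + k)%N else eta z
  else eta.

Lemma move_fun_config k x y (eta : config) :
  move_fun k x y (val eta) \in [set eta : X -> nat | (cnorm eta < +oo)%E].
Proof.
have := set_valP eta; rewrite /= -/(cnorm (val eta)) => etafin.
apply/mem_set => /=.
apply: (@le_lt_trans _ _
  (cnorm (val eta) + \esum_(z in [set y]) (k%:R * (a z)%:num)%:E)%E); last first.
  by rewrite esum_set1 ?lee_fin// lte_add_pinfty// ltry.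
rewrite (esum_mkcond [set y]) /cnorm -esumD; last 2 first.
- by move=> z _; rewrite lee_fin.
- by move=> z _; case: ifP => // _; rewrite lee_fin.
apply: le_esum => z _; rewrite /move_fun.
case: ifPn => [/andP[_ xy]|_]; last first.
  by rewrite leeDl//; case: ifP => // _; rewrite lee_fin.
have [->|zx] := eqVneq z x.
  rewrite -[leLHS]adde0 leeD//; last by case: ifP => // _; rewrite lee_fin.
  by rewrite lee_fin ler_wpM2r// ler_nat leq_subr.
have [->|zy] := eqVneq z y.
  by rewrite mem_set// -EFinD lee_fin natrD mulrDl.
by rewrite leeDl//; case: ifP => // _; rewrite lee_fin.
Qed.

Definition move (k : nat) (x y : X) (eta : config) : config :=
  exist _ (move_fun k x y (val eta)) (move_fun_config k x y eta).

(* States of the countable process. Since [a] is going to be summable, hence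
   bounded, every eta : X -> nat of finite mass has finite norm, so that
   restricting to [config] loses none of them. *)
Definition finite_config :=
  set_type [set eta : config | (\esum_(x in setT) (val eta x)%:R%:E < +oo :> \bar R)%E].

Section dynamics.
Variables (p : X -> X -> R) (g : nat -> nat -> nat -> R).

Definition move_rate (eta : config) (k : nat) (x y : X) : R :=
  p x y * g k (val eta x) (val eta y).

Definition generator (f : config -> R) (eta : config) : R :=
  rsum [set i : X * X * nat | (0 < i.2)%N]
    (fun i => move_rate eta i.2 i.1.1 i.1.2 *
              (f (move i.2 i.1.1 i.1.2 eta) - f eta)).

Definition jump_rate (eta zeta : finite_config) : \bar R :=
  (\esum_(i in [set i : X * X * nat | (0 < i.2)%N /\
                  move i.2 i.1.1 i.1.2 (val eta) = val zeta])
     (move_rate (val eta) i.2 i.1.1 i.1.2)%:E)%E.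

End dynamics.

(* Operators acting on LL: the values of S t outside LL are irrelevant. *)
Record markov_semigroup (S : R -> (config -> R) -> (config -> R)) : Prop := {
  semigroup_LL : forall t f, 0 <= t -> f \in LL -> S t f \in LL;
  semigroup_linear : forall t u f h, 0 <= t -> f \in LL -> h \in LL ->
    S t (fun eta => u * f eta + h eta) = (fun eta => u * S t f eta + S t h eta);
  semigroup0 : forall f, f \in LL -> S 0 f = f;
  semigroupD : forall s t f, 0 <= s -> 0 <= t -> f \in LL ->
    S (s + t) f = S s (S t f);
  semigroup1 : forall t, 0 <= t -> S t (fun=> 1) = (fun=> 1);
  semigroup_ge0 : forall t f, 0 <= t -> f \in LL ->
    (forall eta, 0 <= f eta) -> forall eta, 0 <= S t f eta;
  semigroup_right_cts : forall t f eta, 0 <= t -> f \in LL ->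
    S s f eta @[s --> t^'+] --> S t f eta }.

End configurations.

Arguments LL {R X} a.

(* Continuous-time Markov chains on a state space E, intended to be countable
   with its discrete sigma-algebra. *)
Section markov_chain.
Context {R : realType} {E : choiceType}.
Implicit Types (P : R -> E -> E -> R) (q : E -> E -> \bar R).

Record transition_function P : Prop := {
  transition_ge0 : forall t x y, 0 <= t -> 0 <= P t x y;
  transition_sum1 : forall t x, 0 <= t ->
    \esum_(y in setT) (P t x y)%:E = 1%E;
  transition0 : forall x y, P 0 x y = (x == y)%:R;
  transitionD : forall s t x y, 0 <= s -> 0 <= t ->
    (P (s + t) x y)%:E = \esum_(z in setT) (P s x z * P t z y)%:E }.

(* P h x y = q x y * h + o(h) for y != x, and
   P h x x = 1 - (\sum_(y != x) q x y) * h + o(h), as h decreases to 0.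
   The values q x x play no role. *)
Definition has_jump_rates P q :=
  (forall x y, x != y -> (P h x y / h)%:E @[h --> 0^'+] --> q x y) /\
  (forall x, ((1 - P h x x) / h)%:E @[h --> 0^'+] -->
     \esum_(y in [set y | y != x]) q x y).

Definition markov_with_transition P d (Omega : measurableType d)
    (Pr : probability Omega R) (Y : R -> Omega -> E) :=
  forall (past : seq (R * E)) (s t : R) (x y : E), 0 <= s -> 0 <= t ->
    (forall r, r \in past -> 0 <= r.1 <= s) ->
    let A := [set w | forall r, r \in past -> Y r.1 w = r.2] `&`
             [set w | Y s w = x] in
    Pr (A `&` [set w | Y (s + t) w = y]) = (Pr A * (P t x y)%:E)%E.

(* (Y t)_(t >= 0) is a Markov process with jump rates q started from x0; no path
   regularity is required. *)
Definition markov_jump_process q (x0 : E) d (Omega : measurableType d)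
    (Pr : probability Omega R) (Y : R -> Omega -> E) :=
  [/\ forall t x, 0 <= t -> measurable [set w | Y t w = x],
      Pr [set w | Y 0 w = x0] = 1%E
    & exists P, [/\ transition_function P, has_jump_rates P q
                  & markov_with_transition P Pr Y]].

End markov_chain.

(* Main.v *)
Require Import Defs.
From mathcomp Require Import all_boot all_order all_algebra.
From mathcomp Require Import finmap.
From mathcomp Require Import all_classical all_reals all_analysis.
From mathcomp Require Import measurable_realfun.
From mathcomp Require Import ring lra.
Import Order.TTheory GRing.Theory Num.Theory.
Import numFieldNormedType.Exports.

Set Implicit Arguments.
Unset Strict Implicit.
Unset Printing Implicit Defensive.

Local Open Scope classical_set_scope.
Local Open Scope ring_scope.

(** The generator conserves the number of particles, and on configurations with at most
    [N] particles its total rate is at most [C N]. On such a class everything is done with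
    Euler steps [u + h Q u]: as soon as [h] times the total rate is at most one, such a
    step averages [u], hence is positive, monotone and contracting. Comparing Euler schemes
    on nested grids shows that they converge ([cvg_euler_approx]); the limit is a semigroup
    ([jump_semigroupD]) which differs from an Euler step by O(h^2)
    ([jump_semigroup_local]), and every inequality that holds for Euler steps passes to it.

    The key inequality is [euler_lip]: an Euler step multiplies Lipschitz constants by at
    most [1 + h c], hence the semigroup multiplies them by at most [exp (c t)]. This is the
    basic coupling, transition by transition ([coupling_ineq]): the jumps common to two
    configurations do not change their distance, and the excess jumps of either change it
    at a rate which, by the Lipschitz condition on the rates and the conditions on [p] and
    [a], is at most [c] times the distance. The constant [c] does not depend on the number of
    particles, and finite configurations are dense, so the semigroup extends to all
    configurations by truncation; linearity, positivity and the semigroup property follow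
    by passing to the limit.

    The integral equation holds for finite configurations by the fundamental theorem of
    calculus, since the semigroup has a Taylor expansion with quadratic remainder
    ([integral_taylor]). Along the truncations of an infinite configuration the integrands
    are dominated, because the generator of a Lipschitz function grows linearly with the
    norm ([migration_semigroup_integral]).

    On finite configurations, which are countably many, the semigroup is given by a
    transition function with the prescribed rates ([jump_chain_transition],
    [jump_chain_rates]). It is the only one ([jump_chain_unique]): splitting paths at
    their first jump bounds any such transition function over a time [h] from below by an
    Euler step, up to O(h^2), thus, iterating, by the semigroup; and two stochastic kernels one of
    which dominates the other are equal. So the law of any Markov process with these rates
    is known, and its expectations are given by the semigroup
    ([jump_process_expectation]). *)

(** * Limits along time grids *)

Section grid_limits.
Context {R : realType}.

Lemma near_ge_natr (c : R) : \forall n \near \oo, c <= n.+1%:R.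
Proof.
near=> n; apply: (@le_trans _ _ n%:R); last by rewrite ler_nat.
by near: n; exact: nbhs_infty_ger.
Unshelve. all: by end_near. Qed.

Lemma cvg_divSn (c : R) : c / n.+1%:R @[n --> \oo] --> (0 : R).
Proof. by rewrite -(mulr0 c); apply: cvgM; [exact: cvg_cst|exact: cvg_harmonic]. Qed.

Lemma cvg_divSn_at_right (c : R) : 0 < c -> c / n.+1%:R @[n --> \oo] --> 0^'+.
Proof.
move=> c0 V; rewrite /at_right /within /= => HV.
have [k _ Hk] := cvg_divSn c HV; exists k => // n kn; apply: (Hk n kn) => /=.
exact: divr_gt0.
Qed.

End grid_limits.

(** * Sums of absolutely summable families *)

Section esum_complements.
Context {R : realType} {T : choiceType}.
Implicit Types (D : set T) (f g : T -> R).

Lemma esumZl D f (c : R) : 0 <= c -> (forall i, D i -> 0 <= f i) ->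
  (\esum_(i in D) (c * f i)%:E = c%:E * \esum_(i in D) (f i)%:E)%E.
Proof.
move=> c0 f0; rewrite /esum -ereal_supZl//; last first.
  apply/set0P; exists 0%E; exists set0; first exact: fsets_set0.
  by rewrite fsbig_set0.
have E A : fsets D A ->
    (\sum_(x \in A) (c * f x)%:E = c%:E * \sum_(x \in A) (f x)%:E)%E.
  by move=> [Afin _]; rewrite !fsumEFin// -EFinM -mulr_fsumr.
congr (ereal_sup _); apply/seteqP; split => [_ [A DA <-]|_ [_ [A DA <-] <-]].
  by exists (\sum_(x \in A) (f x)%:E)%E; [exists A|rewrite E].
by exists A => //; rewrite E.
Qed.

Lemma esum_addr D f g : (forall i, D i -> 0 <= f i) -> (forall i, D i -> 0 <= g i) ->
  (\esum_(i in D) (f i + g i)%:E = \esum_(i in D) (f i)%:E + \esum_(i in D) (g i)%:E)%E.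
Proof. by move=> f0 g0; rewrite -esumD. Qed.

Lemma esum_exchange {U : choiceType} (D : set T) (K : set U) (f : T -> U -> \bar R) :
  (forall i j, D i -> K j -> (0 <= f i j)%E) ->
  (\esum_(i in D) \esum_(j in K) f i j = \esum_(j in K) \esum_(i in D) f i j)%E.
Proof.
move=> f0; rewrite esum_esum// esum_esum; last by move=> j i Kj Di; exact: f0.
rewrite (reindex_esum (K `*`` fun=> D) _ (fun x => (x.2, x.1)))//; split=> //=.
- by move=> [i j] [/=].
- by move=> [i1 i2] [j1 j2] /= _ _ [] -> ->.
- by move=> [i1 i2] [Pi1 Qi2] /=; exists (i2, i1).
Qed.

Lemma le_esum_term D f i : (forall i, D i -> 0 <= f i) -> D i ->
  ((f i)%:E <= \esum_(i in D) (f i)%:E)%E.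
Proof.
move=> f0 Di; apply: esum_ge; exists [set i]; last by rewrite fsbig_set1.
by split=> [|_ ->]//; exact: finite_set1.
Qed.

Lemma esum_point (F : T -> R) (x : T) : (forall y, 0 <= F y) ->
  (\esum_(y in setT) ((x == y)%:R * F y)%:E = (F x)%:E)%E.
Proof.
move=> F0; rewrite -[RHS](esum_set1 (t := x) (a := EFin \o F)) ?lee_fin// [RHS]esum_mkcond.
apply: eq_esum => z _; have [->|xz] := eqVneq x z; first by rewrite mem_set// mul1r.
by rewrite mul0r memNset// => /= /esym/eqP; rewrite (negPf xz).
Qed.

Lemma esum_small_tail D f (e : R) : 0 < e -> (forall i, D i -> 0 <= f i) ->
  (\esum_(i in D) (f i)%:E < +oo)%E ->
  exists J : set T, [/\ finite_set J, J `<=` D &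
    (\esum_(i in D `&` ~` J) (f i)%:E <= e%:E)%E].
Proof.
move=> e0 f0 foo.
have ffin : (\esum_(i in D) (f i)%:E)%E \is a fin_num.
  by rewrite ge0_fin_numE// esum_ge0// => i /f0; rewrite lee_fin.
have [_ [J [Jfin JD] <-] sJ] := @ub_ereal_sup_adherent _ _ _ e0 ffin.
exists J; split=> //.
have fD := @esumID _ _ J D (EFin \o f) (fun i Di => f0 i Di).
rewrite (setIidr JD) (esum_fset Jfin)/= in fD; last first.
  by move=> i; rewrite inE => /JD Di; rewrite lee_fin f0.
move: sJ ffin; rewrite -/(esum _ _) fD fsumEFin//.
case: (\esum_(i in _) _)%E => [r| |]//= + _.
rewrite -EFinD !(lee_fin, lte_fin); lra.
Qed.

End esum_complements.

Section rsum_theory.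
Context {R : realType} {T : choiceType}.
Implicit Types (D : set T) (f g : T -> R).

Local Notation summ D f := (summable D (EFin \o f)).

Lemma summ_le D f g : (forall i, D i -> `|f i| <= g i) ->
  (\esum_(i in D) (g i)%:E < +oo)%E -> summ D f.
Proof. by move=> fg; apply: le_lt_trans; apply: le_esum => i Di; rewrite lee_fin fg. Qed.

Lemma summZ D f c : summ D f -> summ D (fun i => c * f i).
Proof.
rewrite /summable => sf; rewrite (eq_esum (b := fun i => (`|c| * `|f i|)%:E)).
  by rewrite esumZl// lte_mul_pinfty// lee_fin.
by move=> i _; rewrite /= normrM.
Qed.

Lemma summD D f g : summ D f -> summ D g -> summ D (fun i => f i + g i).
Proof. exact: summableD. Qed.

Lemma summB D f g : summ D f -> summ D g -> summ D (fun i => f i - g i).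
Proof. exact: summableB. Qed.

Lemma summ_fin D f : (forall i, D i -> 0 <= f i) -> summ D f ->
  (\esum_(i in D) (f i)%:E)%E \is a fin_num.
Proof.
move=> f0; rewrite summableE (eq_esum (b := EFin \o f))// => i /f0 fi.
by rewrite /= ger0_norm.
Qed.

Lemma summ0 D : summ D (fun=> 0 : R).
Proof. by rewrite /summable esum1// => i _; rewrite /= normr0. Qed.

Lemma eq_rsum D f g : (forall i, D i -> f i = g i) -> rsum D f = rsum D g.
Proof.
move=> fg; rewrite /rsum; congr (fine (_ - _)%E); apply: eq_esum => i Di.
  by rewrite !funeposE /= fg.
by rewrite !funenegE /= fg.
Qed.

(** Every other property of [rsum] comes from its value on a difference of two
    nonnegative families. *)
Lemma rsum_sub D f g :
  (forall i, D i -> 0 <= f i) -> (forall i, D i -> 0 <= g i) ->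
  summ D f -> summ D g -> rsum D (fun i => f i - g i) =
    fine (\esum_(i in D) (f i)%:E) - fine (\esum_(i in D) (g i)%:E).
Proof.
move=> f0 g0 sf sg; rewrite /rsum -fineB; [|exact: summ_fin..].
by congr (fine _); rewrite -[RHS](esumB sf sg).
Qed.

Lemma rsum_ge0E D f : (forall i, D i -> 0 <= f i) -> summ D f ->
  (rsum D f)%:E = (\esum_(i in D) (f i)%:E)%E.
Proof.
move=> f0 sf; transitivity (rsum D (fun i => f i - 0))%:E.
  by congr EFin; apply: eq_rsum => i _; rewrite subr0.
rewrite rsum_sub//; last exact: summ0.
by rewrite [X in _ - fine X]esum1// subr0 fineK// summ_fin.
Qed.

Lemma rsum_ge0 D f : (forall i, D i -> 0 <= f i) -> 0 <= rsum D f.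
Proof.
move=> f0; rewrite /rsum [X in (_ - X)%E]esum1; last first.
  by move=> i /f0 fi; rewrite funenegE; apply/max_idPr; rewrite -EFinN lee_fin oppr_le0.
by rewrite sube0 fine_ge0// esum_ge0.
Qed.

Let pos f i := Num.max (f i) 0.
Let neg f i := Num.max (- f i) 0.
Let pos0 f i : 0 <= pos f i. Proof. by rewrite le_max lexx orbT. Qed.
Let neg0 f i : 0 <= neg f i. Proof. by rewrite le_max lexx orbT. Qed.
Let posneg f i : f i = pos f i - neg f i.
Proof. by rewrite /pos /neg; case: (leP (f i)) => ?; case: leP => ?; lra. Qed.
Let spos D f : summ D f -> summ D (pos f).
Proof.
apply: le_lt_trans; apply: le_esum => i _.
by rewrite lee_fin ger0_norm// /pos ge_max ler_norm normr_ge0.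
Qed.
Let sneg D f : summ D f -> summ D (neg f).
Proof.
apply: le_lt_trans; apply: le_esum => i _.
by rewrite lee_fin ger0_norm// /neg ge_max -normrN ler_norm normr_ge0.
Qed.

Lemma rsumD D f g : summ D f -> summ D g ->
  rsum D (fun i => f i + g i) = rsum D f + rsum D g.
Proof.
move=> sf sg; transitivity
  (rsum D (fun i => (pos f i + pos g i) - (neg f i + neg g i))).
  by apply: eq_rsum => i _; rewrite (posneg f) (posneg g); lra.
rewrite rsum_sub ?(eq_rsum (fun i _ => posneg f i)) ?(eq_rsum (fun i _ => posneg g i)).
- rewrite !rsum_sub//; try solve [exact: spos|exact: sneg].
  rewrite !esum_addr// !fineD; try by apply: summ_fin => //; solve [exact: spos|exact: sneg].
  by rewrite opprD addrACA.
- by move=> i _; rewrite addr_ge0.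
- by move=> i _; rewrite addr_ge0.
- by apply: summD; exact: spos.
- by apply: summD; exact: sneg.
Qed.

Lemma rsumZ D f c : summ D f -> rsum D (fun i => c * f i) = c * rsum D f.
Proof.
wlog c0 : c f / 0 <= c => [H sf|sf].
  have [c0|c0] := leP 0 c; first exact: H.
  have := H (- c) f; rewrite oppr_ge0 (ltW c0) => /(_ isT sf) E.
  have : rsum D (fun i => c * f i) + rsum D (fun i => - c * f i) = 0.
    rewrite -rsumD; [|exact: summZ..].
    rewrite (eq_rsum (g := fun=> 0 - 0)); last by move=> i _; lra.
    by rewrite rsum_sub ?subrr//; exact: summ0.
  by rewrite E mulNr => /eqP; rewrite subr_eq0 => /eqP.
transitivity (rsum D (fun i => c * pos f i - c * neg f i)).
  by apply: eq_rsum => i _; rewrite (posneg f) mulrBr.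
have cpos : summ D (fun i => c * pos f i) by apply: summZ; exact: spos.
have cneg : summ D (fun i => c * neg f i) by apply: summZ; exact: sneg.
rewrite rsum_sub//; [|by move=> i _; rewrite mulr_ge0..].
rewrite (eq_rsum (fun i _ => posneg f i)) rsum_sub//; [|exact: spos|exact: sneg].
rewrite esumZl// esumZl// fineM//; last by apply: summ_fin => //; exact: spos.
by rewrite fineM ?mulrBr//; apply: summ_fin => //; exact: sneg.
Qed.

Lemma rsumB D f g : summ D f -> summ D g ->
  rsum D (fun i => f i - g i) = rsum D f - rsum D g.
Proof.
move=> sf sg; rewrite -[- rsum D g]mulN1r -rsumZ// -rsumD//; last exact: summZ.
by apply: eq_rsum => i _; rewrite mulN1r.
Qed.

Lemma ler_rsum D f g : summ D f -> summ D g -> (forall i, D i -> f i <= g i) ->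
  rsum D f <= rsum D g.
Proof.
move=> sf sg fg; rewrite -subr_ge0 -rsumB//; apply: rsum_ge0 => i /fg.
by rewrite subr_ge0.
Qed.

Lemma rsum_norm_le D f g (B : R) : (forall i, D i -> `|f i| <= g i) ->
  (\esum_(i in D) (g i)%:E <= B%:E)%E -> `|rsum D f| <= B.
Proof.
move=> fg gB.
have g0 i : D i -> 0 <= g i by move=> Di; exact: le_trans (fg _ Di).
have sf : summ D f by apply: summ_le fg _; apply: le_lt_trans gB _; rewrite ltry.
have sg : summ D g.
  apply: summ_le (le_lt_trans gB (ltry _)) => i Di; rewrite ger0_norm// g0//.
have gB' : rsum D g <= B by rewrite -lee_fin rsum_ge0E.
rewrite ler_norml; apply/andP; split.
  rewrite lerNl; apply: le_trans gB'; rewrite -mulN1r -rsumZ//.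
  apply: ler_rsum => // [|i Di]; first exact: summZ.
  by rewrite mulN1r; apply: le_trans (fg _ Di); rewrite -normrN ler_norm.
by apply: le_trans gB'; apply: ler_rsum => // i Di; apply: le_trans (fg _ Di); rewrite ler_norm.
Qed.

Lemma rsum_dominated_cvg {U : Type} (F : set_system U) {FF : ProperFilter F} D
    (f_ : U -> T -> R) f g :
  (forall u i, D i -> `|f_ u i| <= g i) ->
  (\esum_(i in D) (g i)%:E < +oo)%E ->
  (forall i, D i -> f_ u i @[u --> F] --> f i) ->
  rsum D (f_ u) @[u --> F] --> rsum D f.
Proof.
move=> fg goo fcv.
have [u0 _] := filter_ex (@filterT _ F _).
have g0 i : D i -> 0 <= g i by move=> Di; apply: le_trans (fg u0 _ Di).
have fg' i : D i -> `|f i| <= g i.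
  move=> Di; apply: (@cvgr_to_le _ F _ R (fun u => `|f_ u i|)).
    by apply: cvg_norm; exact: fcv.
  by apply: nearW => u; exact: fg.
have sf_ u : summ D (f_ u) by apply: summ_le goo; exact: fg.
have sf : summ D f by apply: summ_le goo.
apply/cvgrPdist_le => e e0.
have e4 : 0 < e / 4 by lra.
have [J [Jfin JD Jt]] := esum_small_tail e4 g0 goo.
have hJ : \sum_(i <- fset_set J | i \in fset_set J) `|f i - f_ u i| @[u --> F] --> (0 : R).
  have := @cvg_big R T +%R 0 (fun i => i \in fset_set J) add_continuous U F (fset_set J)
    (fun i u => `|f i - f_ u i|) (fun=> 0) _.
  rewrite big1//; apply => i; rewrite in_fset_set// inE => /JD Di.
  rewrite -(normr0 R) -(subrr (f i)); apply: cvg_norm; apply: cvgB; first exact: cvg_cst.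
  exact: fcv.
have e2 : 0 < e / 2 by lra.
move/cvgrPdist_le : hJ => /(_ _ e2); apply: filterS => u.
rewrite sub0r normrN -big_seq ger0_norm ?sumr_ge0// => hu.
rewrite -rsumB//; apply: (rsum_norm_le (g := fun i => `|f i - f_ u i|)) => //.
rewrite (esumID J)//= (setIidr JD).
rewrite (esum_fset Jfin)// fsumEFin// fsbig_finite//=.
have -> : e = e / 2 + 2 * (e / 4) by lra.
rewrite EFinD leeD ?lee_fin//.
apply: (@le_trans _ _ (\esum_(i in D `&` ~` J) (2 * g i)%:E)%E).
  apply: le_esum => i [Di _]; rewrite lee_fin (le_trans (ler_normB _ _))//.
  by rewrite mulr_natl mulr2n lerD// ?fg ?fg'.
rewrite esumZl//; last by move=> i [/g0].
by rewrite EFinM lee_wpmul2l// lee_fin.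
Qed.

End rsum_theory.

(** * A fundamental theorem of calculus for quadratic Taylor estimates *)

Section quadratic_taylor.
Context {R : realType}.
Variables (phi psi : R -> R) (K : R).
Hypothesis K_ge0 : 0 <= K.
Hypothesis taylor : forall s s', 0 <= s -> 0 <= s' ->
  `|phi s' - phi s - (s' - s) * psi s| <= K * (s' - s) ^+ 2.

(** Add the expansions of [phi] at [s] and at [s']. *)
Let psi_lipschitz s s' : 0 <= s -> 0 <= s' -> `|psi s - psi s'| <= 2 * K * `|s - s'|.
Proof.
move=> s0 s0'; have [->|ss'] := eqVneq s s'; first by rewrite !subrr normr0 mulr0.
have d0 : 0 < `|s - s'| by rewrite normr_gt0 subr_eq0.
rewrite -(ler_pM2r d0) -normrM.
have -> : (psi s - psi s') * (s - s') =
  (phi s - phi s' - (s - s') * psi s') + (phi s' - phi s - (s' - s) * psi s) by ring.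
have -> : 2 * K * `|s - s'| * `|s - s'| = K * (s - s') ^+ 2 + K * (s' - s) ^+ 2.
  by rewrite -mulrA -expr2 real_normK ?num_real//; ring.
by apply: le_trans (ler_normD _ _) _; rewrite lerD// taylor.
Qed.

Lemma taylor_continuous t : {within `[0, t], continuous psi}.
Proof.
(* the estimate says nothing about negative times, so [psi] is frozen there *)
pose psi0 s := psi (Num.max s 0).
apply: (@subspace_eq_continuous _ _ _ (psi0 : R -> R)).
  move=> s; rewrite inE /= in_itv /= => /andP[s0 _].
  by rewrite /psi0 /from_subspace /= max_l.
apply: continuous_subspaceT => s; apply/cvgrPdist_le => e e0.
have K1 : 0 < 2 * K + 1 by have := K_ge0; lra.
have : \forall s' \near s, `|s - s'| < e / (2 * K + 1).
  exact: nbhsx_ballx (divr_gt0 e0 K1).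
apply: filterS => s' ss'.
have m0 (r : R) : 0 <= Num.max r 0 by rewrite le_max lexx orbT.
apply: le_trans (psi_lipschitz (m0 _) (m0 _)) _.
have mm : `|Num.max s 0 - Num.max s' 0| <= `|s - s'|.
  rewrite ler_norml; have := ler_norm (s - s'); have := ler_norm (s' - s).
  rewrite (distrC s' s); have := normr_ge0 (s - s').
  by case: (leP s 0) => ?; case: (leP s' 0) => ? ? ? ?; apply/andP; split; lra.
move: ss'; rewrite ltr_pdivlMr// => ss'.
have := normr_ge0 (Num.max s 0 - Num.max s' 0).
nra.
Qed.

Let taylor_cvg s : 0 < s ->
  h^-1 *: ((phi \o shift s) (h *: (1 : R)) - phi s) @[h --> 0^'] --> psi s.
Proof.
move=> s0; apply/cvgrPdist_le => e e0.
have K1 : 0 < K + 1 by have := K_ge0; lra.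
near=> h.
have h0 : h != 0 by near: h; exact: nbhs_dnbhs_neq.
have hs : `|h| < s.
  by near: h; apply: dnbhs0_lt.
have he : `|h| <= e / (K + 1) by near: h; apply: dnbhs0_le; rewrite divr_gt0.
have sh : 0 <= h + s by move: hs; rewrite ltr_norml => /andP[]; lra.
rewrite /= /shift /= [h *: 1]mulr1.
have -> : psi s - h^-1 *: (phi (h + s) - phi s) =
    - (h^-1 * (phi (h + s) - phi s - (h + s - s) * psi s)).
  by rewrite /GRing.scale /=; field.
rewrite normrN normrM normfV ler_pdivrMl ?normr_gt0//.
apply: le_trans (taylor (ltW s0) sh) _; rewrite addrK -[h ^+ 2]real_normK ?num_real//.
rewrite expr2; move: he; rewrite ler_pdivlMr// => he.
have := normr_ge0 h; nra.
Unshelve. all: by end_near. Qed.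

Lemma integral_taylor t : 0 <= t ->
  (\int[@lebesgue_measure R]_(s in `[0%R, t]) (psi s)%:E = (phi t - phi 0)%:E)%E.
Proof.
rewrite le_eqVlt => /orP[/eqP <-|t0].
  by rewrite set_itv1 integral_set1 subrr.
have D s : 0 < s -> derivable phi s 1.
  by move=> s0; apply/cvg_ex; exists (psi s); exact: taylor_cvg.
rewrite (continuous_FTC2 (F := phi) t0)//; first exact: taylor_continuous.
- split.
  + by move=> s; rewrite in_itv /= => /andP[s0 _]; exact: D.
  + apply/cvgrPdist_le => e e0.
    have c0 : 0 < `|psi 0| + K + 1 by have := K_ge0; have := normr_ge0 (psi 0); lra.
    near=> s.
    have s0 : 0 < s by near: s; exact: nbhs_right_gt.
    have s1 : s <= 1 by near: s; apply: nbhs_right_le.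
    have se : s <= e / (`|psi 0| + K + 1).
      by near: s; apply: nbhs_right_le; rewrite divr_gt0.
    have := taylor (lexx 0) (ltW s0); rewrite subr0 => h.
    rewrite distrC -[X in `|X|](subrK (s * psi 0)).
    apply: le_trans (ler_normD _ _) _; apply: le_trans (lerD h (lexx _)) _.
    rewrite normrM (gtr0_norm s0); move: se; rewrite ler_pdivlMr//.
    have : K * s ^+ 2 <= K * s by rewrite ler_wpM2l// expr2 ler_piMl// ltW.
    lra.
  + apply: cvg_at_left_filter.
    apply: differentiable_continuous; apply/derivable1_diffP; exact: D.
- move=> s; rewrite in_itv /= => /andP[s0 _].
  by rewrite derive1E; apply/cvg_lim => //; exact: taylor_cvg.
Unshelve. all: by end_near. Qed.

End quadratic_taylor.

(** * Bounded jump operators and their semigroups *)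

Section jump_operator.
Context {R : realType} {E : Type} {I : choiceType}.
Variables (D : set I) (r : E -> I -> R) (m : E -> I -> E).
Implicit Types (A : set E) (u v w : E -> R) (x : E) (h t B : R).

(** A function is only controlled on a class [A] of states that jumps do not leave, since
    the total jump rate may be unbounded on the whole state space. *)
Definition bounded_on A u B := forall x, A x -> `|u x| <= B.

Definition jump_gen u x := rsum D (fun i => r x i * (u (m x i) - u x)).

Definition euler_step h u x := u x + h * jump_gen u x.

Definition euler_approx t u n := iter n (euler_step (t / n%:R)) u.

(** The exponential of [t] times the generator, as a limit of Euler schemes and not as a
    power series: positivity and contraction hold for small Euler steps, but not for the
    partial sums of the exponential. *)
Definition jump_semigroup t u x : R := limn (fun n => euler_approx t u n.+1 x).

Definition bounded_rates A lam :=
  [/\ forall x i, 0 <= r x i, 0 <= lam, forall x i, A x -> D i -> A (m x i)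
    & forall x, A x -> (\esum_(i in D) (r x i)%:E <= lam%:E)%E].

Lemma bounded_on_ge0 A u B x : A x -> bounded_on A u B -> 0 <= B.
Proof. by move=> Ax uB; apply: le_trans (uB _ Ax). Qed.

Lemma jump_gen_cst (c : R) x : jump_gen (fun=> c) x = 0.
Proof.
rewrite /jump_gen (eq_rsum (g := fun=> 0 - 0)); last by move=> i _; rewrite subrr mulr0 subrr.
by rewrite rsum_sub ?subrr//; exact: summ0.
Qed.

Lemma euler_cst h (c : R) : euler_step h (fun=> c) = fun=> c.
Proof. by apply/funext => x; rewrite /euler_step jump_gen_cst mulr0 addr0. Qed.

Section bounded_rates.
Variables (A : set E) (lam : R).
Hypothesis Alam : bounded_rates A lam.

Let r_ge0 x i : 0 <= r x i. Proof. by case: Alam. Qed.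
Let lam_ge0 : 0 <= lam. Proof. by case: Alam. Qed.
Let A_closed x i : A x -> D i -> A (m x i). Proof. by case: Alam => _ _ + _; exact. Qed.
Let r_le x : A x -> (\esum_(i in D) (r x i)%:E <= lam%:E)%E.
Proof. by case: Alam => _ _ _; exact. Qed.

Local Notation Q := jump_gen.

Let jump_term_le u B x i : bounded_on A u B -> A x -> D i ->
  `|r x i * (u (m x i) - u x)| <= 2 * B * r x i.
Proof.
move=> uB Ax Di; rewrite normrM ger0_norm// mulrC ler_wpM2r//.
rewrite (le_trans (ler_normB _ _))// mulr_natl mulr2n lerD// uB//.
exact: A_closed.
Qed.

Let jump_term_esum B x : 0 <= B -> A x ->
  (\esum_(i in D) (2 * B * r x i)%:E <= (2 * B * lam)%:E)%E.
Proof.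
move=> B0 Ax; rewrite esumZl ?mulr_ge0// (EFinM _ lam).
by rewrite lee_wpmul2l ?r_le// lee_fin mulr_ge0.
Qed.

Let jump_summ u B x : bounded_on A u B -> A x ->
  summable D (EFin \o (fun i => r x i * (u (m x i) - u x))).
Proof.
move=> uB Ax; apply: (summ_le (fun i => @jump_term_le u B x i uB Ax)).
by apply: le_lt_trans (jump_term_esum _ Ax) (ltry _); exact: bounded_on_ge0 Ax uB.
Qed.

Lemma bounded_on_jump_gen u B : bounded_on A u B -> bounded_on A (Q u) (2 * B * lam).
Proof.
move=> uB x Ax; apply: (rsum_norm_le (fun i => @jump_term_le u B x i uB Ax)).
by apply: jump_term_esum => //; exact: bounded_on_ge0 Ax uB.
Qed.

Lemma eq_jump_gen u v : (forall x, A x -> u x = v x) ->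
  forall x, A x -> Q u x = Q v x.
Proof.
by move=> uv x Ax; apply: eq_rsum => i Di; rewrite !uv//; exact: A_closed.
Qed.

Lemma jump_gen_linear (c : R) u v B B' x : bounded_on A u B -> bounded_on A v B' ->
  A x -> Q (fun y => c * u y + v y) x = c * Q u x + Q v x.
Proof.
move=> uB vB Ax; rewrite /Q -rsumZ; last exact: jump_summ uB Ax.
rewrite -rsumD; [|apply: summZ; exact: jump_summ uB Ax|exact: jump_summ vB Ax].
by apply: eq_rsum => i _; ring.
Qed.

Lemma bounded_on_lin (c : R) u v B B' : bounded_on A u B -> bounded_on A v B' ->
  bounded_on A (fun y => c * u y + v y) (`|c| * B + B').
Proof.
move=> uB vB x Ax; rewrite (le_trans (ler_normD _ _))// lerD ?vB//.
by rewrite normrM ler_wpM2l// uB.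
Qed.

Lemma jump_genB u v B B' x : bounded_on A u B -> bounded_on A v B' ->
  A x -> Q (fun y => u y - v y) x = Q u x - Q v x.
Proof.
move=> uB vB Ax.
have -> : (fun y => u y - v y) = (fun y => -1 * v y + u y).
  by apply/funext => y; ring.
by rewrite (jump_gen_linear _ vB uB)//; ring.
Qed.

Lemma bounded_onB u v B B' : bounded_on A u B -> bounded_on A v B' ->
  bounded_on A (fun y => u y - v y) (B + B').
Proof.
by move=> uB vB x Ax; rewrite (le_trans (ler_normB _ _))// lerD ?uB ?vB.
Qed.

Lemma eq_euler h u v : (forall x, A x -> u x = v x) ->
  forall x, A x -> euler_step h u x = euler_step h v x.
Proof. by move=> uv x Ax; rewrite /euler_step (uv _ Ax) (eq_jump_gen uv). Qed.

Lemma euler_linear h (c : R) u v B B' x : bounded_on A u B -> bounded_on A v B' ->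
  A x -> euler_step h (fun y => c * u y + v y) x = c * euler_step h u x + euler_step h v x.
Proof. by move=> uB vB Ax; rewrite /euler_step (jump_gen_linear _ uB vB)//; ring. Qed.

Lemma eulerB h u v B B' x : bounded_on A u B -> bounded_on A v B' ->
  A x -> euler_step h (fun y => u y - v y) x = euler_step h u x - euler_step h v x.
Proof. by move=> uB vB Ax; rewrite /euler_step (jump_genB uB vB)//; ring. Qed.

(** [u x + h Q u x] gives the weight [1 - h * (total rate)] to [u x], and positive weights
    to the values of [u] at the targets of the jumps. *)
Lemma euler_ge0 h u B : 0 <= h -> h * lam <= 1 -> bounded_on A u B ->
  (forall x, A x -> 0 <= u x) -> forall x, A x -> 0 <= euler_step h u x.
Proof.
move=> h0 hlam uB u0 x Ax.
have B0 := bounded_on_ge0 Ax uB.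
have sr : summable D (EFin \o r x).
  by apply: (summ_le (g := r x)) => [i _|]; [rewrite ger0_norm|exact: le_lt_trans (r_le Ax) (ltry _)].
have Qge : - (u x * lam) <= Q u x.
  apply: (@le_trans _ _ (rsum D (fun i => (- u x) * r x i))).
    rewrite rsumZ// mulNr lerN2 ler_wpM2l ?u0//.
    by rewrite -lee_fin rsum_ge0E// r_le.
  apply: ler_rsum; [exact: summZ|exact: jump_summ uB Ax|].
  move=> i Di; rewrite mulrC ler_wpM2l// lerBrDl subrr u0//.
  exact: A_closed.
rewrite /euler_step; have := u0 _ Ax; nra.
Qed.

Lemma ler_euler h u v B B' : 0 <= h -> h * lam <= 1 ->
  bounded_on A u B -> bounded_on A v B' -> (forall x, A x -> u x <= v x) ->
  forall x, A x -> euler_step h u x <= euler_step h v x.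
Proof.
move=> h0 hlam uB vB uv x Ax; rewrite -subr_ge0 -(eulerB _ vB uB)//.
apply: (euler_ge0 h0 hlam (bounded_onB vB uB)) => // y Ay.
by rewrite subr_ge0 uv.
Qed.

(** A small Euler step replaces a function by its averages, as [euler_ge0] shows. *)
Lemma bounded_on_euler h u B : 0 <= h -> h * lam <= 1 -> bounded_on A u B ->
  bounded_on A (euler_step h u) B.
Proof.
move=> h0 hlam uB x Ax.
have cB (c : R) : bounded_on A (fun=> c) `|c| by [].
rewrite ler_norml; apply/andP; split.
  rewrite -[leLHS](_ : euler_step h (fun=> - B) x = _); last by rewrite euler_cst.
  by apply: (ler_euler h0 hlam (cB _) uB) => // y /uB; rewrite ler_norml => /andP[].
rewrite -[leRHS](_ : euler_step h (fun=> B) x = _); last by rewrite euler_cst.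
by apply: (ler_euler h0 hlam uB (cB _)) => // y /uB; rewrite ler_norml => /andP[].
Qed.

Lemma bounded_on_iter_euler h u B n : 0 <= h -> h * lam <= 1 -> bounded_on A u B ->
  bounded_on A (iter n (euler_step h) u) B.
Proof. by move=> h0 hlam uB; elim: n => //= n; exact: bounded_on_euler. Qed.

Lemma eq_iter_euler h u v n : (forall x, A x -> u x = v x) ->
  forall x, A x -> iter n (euler_step h) u x = iter n (euler_step h) v x.
Proof. by move=> uv; elim: n => //= n; exact: eq_euler. Qed.

Lemma iter_euler_linear h (c : R) u v B B' n x : 0 <= h -> h * lam <= 1 ->
  bounded_on A u B -> bounded_on A v B' -> A x ->
  iter n (euler_step h) (fun y => c * u y + v y) x =
  c * iter n (euler_step h) u x + iter n (euler_step h) v x.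
Proof.
move=> h0 hlam uB vB; elim: n x => // n IHn x Ax.
rewrite !iterS (eq_euler _ IHn)//.
exact: (euler_linear _ _ (bounded_on_iter_euler n h0 hlam uB)
                         (bounded_on_iter_euler n h0 hlam vB)).
Qed.

Lemma iter_euler_ge0 h u B n : 0 <= h -> h * lam <= 1 -> bounded_on A u B ->
  (forall x, A x -> 0 <= u x) -> forall x, A x -> 0 <= iter n (euler_step h) u x.
Proof.
move=> h0 hlam uB u0; elim: n => //= n IHn; apply: (euler_ge0 (B := B)) => //.
exact: bounded_on_iter_euler.
Qed.

(** Discrete Gronwall estimates: since an Euler step is monotone and fixes constants,
    one-step errors just add up. *)
Lemma euler_stable_ge h (v_ : nat -> E -> R) e B n : 0 <= h -> h * lam <= 1 ->
  (forall j, bounded_on A (v_ j) B) ->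
  (forall j x, A x -> euler_step h (v_ j) x - e <= v_ j.+1 x) ->
  forall x, A x -> iter n (euler_step h) (v_ 0%N) x - n%:R * e <= v_ n x.
Proof.
move=> h0 hlam vB ve; elim: n => [|n IHn] x Ax; first by rewrite mul0r subr0.
apply: le_trans (ve _ _ Ax); rewrite -addn1 natrD mulrDl mul1r opprD addrA lerD2r.
rewrite lerBlDr addn1 iterS.
have cB (c : R) : bounded_on A (fun=> c) `|c| by [].
have <- : euler_step h (fun y => 1 * v_ n y + n%:R * e) x = euler_step h (v_ n) x + n%:R * e.
  by rewrite (euler_linear _ _ (vB n) (cB _))// euler_cst mul1r.
apply: (ler_euler h0 hlam (B := B) (B' := `|1| * B + `|n%:R * e|)) => //.
- exact: bounded_on_iter_euler.
- exact: bounded_on_lin.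
- by move=> y Ay; rewrite mul1r -lerBlDr IHn.
Qed.

Lemma euler_stable h (v_ : nat -> E -> R) e B n : 0 <= h -> h * lam <= 1 ->
  (forall j, bounded_on A (v_ j) B) ->
  (forall j x, (j < n)%N -> A x -> `|v_ j.+1 x - euler_step h (v_ j) x| <= e) ->
  forall x, A x -> `|v_ n x - iter n (euler_step h) (v_ 0%N) x| <= n%:R * e.
Proof.
move=> h0 hlam vB; elim: n => [|n IHn] ve x Ax; first by rewrite subrr normr0 mul0r.
have {}IHn := IHn (fun j x jn => ve j x (ltnW jn)).
have itB := bounded_on_iter_euler n h0 hlam (vB 0%N).
have -> : v_ n.+1 x - iter n.+1 (euler_step h) (v_ 0%N) x =
    (v_ n.+1 x - euler_step h (v_ n) x) +
    euler_step h (fun y => v_ n y - iter n (euler_step h) (v_ 0%N) y) x.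
  by rewrite (eulerB _ (vB n) itB)//=; ring.
rewrite (le_trans (ler_normD _ _))// -natr1 mulrDl mul1r addrC lerD ?ve//.
exact: (bounded_on_euler h0 hlam IHn).
Qed.

Lemma iter_euler_drift h u B n : 0 <= h -> h * lam <= 1 -> bounded_on A u B ->
  bounded_on A (fun x => iter n (euler_step h) u x - u x) (n%:R * (h * (2 * B * lam))).
Proof.
move=> h0 hlam uB; elim: n => [|n IHn] x Ax; first by rewrite subrr normr0 mul0r.
rewrite [iter _ _ _]iterS {1}/euler_step addrAC (le_trans (ler_normD _ _))//.
rewrite -natr1 mulrDl mul1r lerD ?IHn// normrM ger0_norm// ler_wpM2l//.
by apply: bounded_on_jump_gen => //; exact: bounded_on_iter_euler.
Qed.

(** The first step has increment [h Q u], and the increments of later steps differ from it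
    by O(h) times the elapsed time. The bound depends on [n] and [h] only through the total
    time [n h], hence survives refinement of the grid. *)
Lemma iter_euler_local h u B n x : 0 <= h -> h * lam <= 1 -> bounded_on A u B -> A x ->
  `|iter n (euler_step h) u x - euler_step (n%:R * h) u x| <= 2 * lam ^+ 2 * (n%:R * h) ^+ 2 * B.
Proof.
move=> h0 hlam uB Ax; elim: n => [|n IHn].
  by rewrite !mul0r /euler_step mul0r addr0 subrr normr0 expr0n mulr0 mul0r.
have B0 := bounded_on_ge0 Ax uB.
have itB := bounded_on_iter_euler n h0 hlam uB.
have dB := bounded_on_jump_gen (iter_euler_drift n h0 hlam uB) Ax.
rewrite [Q _ _](jump_genB itB uB)// in dB.
have -> : iter n.+1 (euler_step h) u x - euler_step (n.+1%:R * h) u x =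
    (iter n (euler_step h) u x - euler_step (n%:R * h) u x) +
    h * (Q (iter n (euler_step h) u) x - Q u x).
  by rewrite iterS /euler_step -natr1; ring.
apply: (le_trans (ler_normD _ _)); apply: (le_trans (lerD IHn (lexx _))).
rewrite normrM ger0_norm//; move/(ler_wpM2l h0): dB.
set q := h * `|_| => dB; apply: (le_trans (lerD (lexx _) dB)).
rewrite -natr1 -subr_ge0.
rewrite [leRHS](_ : _ = 2 * (lam * h) ^+ 2 * B); last by ring.
by rewrite !mulr_ge0// exprn_ge0// mulr_ge0.
Qed.

Local Notation K B := (2 * lam ^+ 2 * B).

Lemma bounded_on_euler_approx t u B n : 0 <= t -> t * lam <= n.+1%:R ->
  bounded_on A u B -> bounded_on A (euler_approx t u n.+1) B.
Proof.
move=> t0 tn; apply: bounded_on_iter_euler; first exact: divr_ge0.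
by rewrite mulrAC ler_pdivrMr// mul1r.
Qed.

(** The discrepancy O(h^2) of each of the [n] coarse steps adds up to O(1/n), whatever the
    refinement: this is what makes the schemes a Cauchy sequence. *)
Lemma euler_approx_refine t u B n k x : 0 <= t -> t * lam <= n.+1%:R ->
  bounded_on A u B -> A x ->
  `|euler_approx t u (k.+1 * n.+1)%N x - euler_approx t u n.+1 x| <=
    K B * t ^+ 2 / n.+1%:R.
Proof.
move=> t0 tn uB Ax.
have n0 : n.+1%:R != 0 :> R by [].
have k0 : k.+1%:R != 0 :> R by [].
pose h := t / (k.+1 * n.+1)%:R.
have h0 : 0 <= h by exact: divr_ge0.
have kh : k.+1%:R * h = t / n.+1%:R by rewrite /h natrM invfM mulrCA mulVKf.
have khlam : t / n.+1%:R * lam <= 1 by rewrite mulrAC ler_pdivrMr// mul1r.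
have hlam : h * lam <= 1.
  apply: le_trans khlam; rewrite -kh ler_wpM2r// ler_peMl// ler1n.
  by [].
pose v_ j := iter (j * k.+1) (euler_step h) u.
have vB j : bounded_on A (v_ j) B by exact: bounded_on_iter_euler.
have -> : euler_approx t u (k.+1 * n.+1) = v_ n.+1.
  by rewrite /v_ (mulnC n.+1).
apply: le_trans (@euler_stable (t / n.+1%:R) v_ (K B * (t / n.+1%:R) ^+ 2) B n.+1
  _ khlam vB _ x Ax) _; first exact: divr_ge0.
  move=> j y _ Ay; rewrite /v_ mulSn iterD -kh.
  rewrite [leRHS](_ : _ = 2 * lam ^+ 2 * (k.+1%:R * h) ^+ 2 * B); last by ring.
  by apply: iter_euler_local => //; exact: bounded_on_iter_euler.
rewrite le_eqVlt; apply/orP; left; apply/eqP.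
by move: (n.+1%:R) n0 => N N0; field.
Qed.

Lemma euler_approx_cauchy t u B n n' x : 0 <= t ->
  t * lam <= n.+1%:R -> t * lam <= n'.+1%:R -> bounded_on A u B -> A x ->
  `|euler_approx t u n.+1 x - euler_approx t u n'.+1 x| <=
    K B * t ^+ 2 / n.+1%:R + K B * t ^+ 2 / n'.+1%:R.
Proof.
move=> t0 tn tn' uB Ax; apply: le_trans (ler_distD (euler_approx t u (n'.+1 * n.+1)%N x) _ _) _.
rewrite lerD//; first by rewrite distrC euler_approx_refine.
by rewrite mulnC euler_approx_refine.
Qed.

Lemma cvg_euler_approx t u B x : 0 <= t -> bounded_on A u B -> A x ->
  euler_approx t u n.+1 x @[n --> \oo] --> jump_semigroup t u x.
Proof.
move=> t0 uB Ax; apply: cauchy_cvg; apply: cauchy_exP => e e0.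
have e2 : 0 < e / 2 by rewrite divr_gt0.
have : \forall n \near \oo, t * lam <= n.+1%:R /\ `|K B * t ^+ 2 / n.+1%:R| < e / 2.
  near=> n; split; first by near: n; exact: near_ge_natr.
  near: n; have /cvgrPdist_lt/(_ _ e2) := cvg_divSn (K B * t ^+ 2).
  by apply: filterS => n; rewrite sub0r normrN.
move=> [N _ HN].
exists (euler_approx t u N.+1 x); exists N => // n' /= Nn'.
have [[tn en] [tn' en']] := (HN N (leqnn N), HN n' Nn').
rewrite /ball /=.
apply: (le_lt_trans (euler_approx_cauchy t0 tn tn' uB Ax)).
move: en en'; rewrite !ltr_norml => /andP[_ en] /andP[_ en'].
by rewrite [ltRHS]splitr ltrD.
Unshelve. all: by end_near. Qed.

Lemma jump_semigroup_rate t u B n x : 0 <= t -> t * lam <= n.+1%:R ->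
  bounded_on A u B -> A x ->
  `|jump_semigroup t u x - euler_approx t u n.+1 x| <= K B * t ^+ 2 / n.+1%:R.
Proof.
move=> t0 tn uB Ax.
apply: (@ler_cvg_to _ (\oo : set_system nat) _ R
  (fun k => `|euler_approx t u k.+1 x - euler_approx t u n.+1 x|)
  (fun k => K B * t ^+ 2 / n.+1%:R + K B * t ^+ 2 / k.+1%:R)).
- by apply: cvg_norm; apply: cvgB; [exact: cvg_euler_approx uB Ax|exact: cvg_cst].
- by rewrite -[X in _ --> X]addr0; apply: cvgD; [exact: cvg_cst|exact: cvg_divSn].
- near=> k; rewrite [leRHS]addrC; apply: (euler_approx_cauchy t0 _ tn uB Ax).
  by near: k; exact: near_ge_natr.
Unshelve. all: by end_near. Qed.
Local Notation T := jump_semigroup.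

Lemma eq_jump_semigroup t u v : (forall x, A x -> u x = v x) ->
  forall x, A x -> T t u x = T t v x.
Proof.
move=> uv x Ax; rewrite /T; congr (lim (_ @ \oo)).
by apply/funext => n; exact: eq_iter_euler.
Qed.

Lemma jump_semigroup_ge0 t u B : 0 <= t -> bounded_on A u B ->
  (forall x, A x -> 0 <= u x) -> forall x, A x -> 0 <= T t u x.
Proof.
move=> t0 uB u0 x Ax; apply: (cvgr_to_ge (cvg_euler_approx t0 uB Ax)).
near=> n; apply: (iter_euler_ge0 _ _ _ uB u0 Ax); first exact: divr_ge0.
rewrite mulrAC ler_pdivrMr// mul1r.
by near: n; exact: near_ge_natr.
Unshelve. all: by end_near. Qed.

Lemma bounded_on_jump_semigroup t u B : 0 <= t -> bounded_on A u B ->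
  bounded_on A (T t u) B.
Proof.
move=> t0 uB x Ax.
apply: (@cvgr_to_le _ (\oo : set_system nat) _ R (fun n => `|euler_approx t u n.+1 x|)).
  by apply: cvg_norm; exact: cvg_euler_approx uB Ax.
near=> n; apply: (bounded_on_euler_approx t0 _ uB Ax).
by near: n; exact: near_ge_natr.
Unshelve. all: by end_near. Qed.

Lemma jump_semigroup_cst t (c : R) x : T t (fun=> c) x = c.
Proof.
rewrite /T; apply/cvg_lim => //.
rewrite (_ : (fun n => _) = fun=> c); first exact: cvg_cst.
apply/funext => n; rewrite /euler_approx; move: (t / _) => h.
have -> // : forall k, iter k (euler_step h) (fun=> c) = fun=> c.
by elim=> //= k ->; rewrite euler_cst.
Qed.

Lemma jump_semigroup_linear t (c : R) u v B B' x : 0 <= t ->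
  bounded_on A u B -> bounded_on A v B' -> A x ->
  T t (fun y => c * u y + v y) x = c * T t u x + T t v x.
Proof.
move=> t0 uB vB Ax; apply/cvg_lim => //.
have : c * euler_approx t u n.+1 x + euler_approx t v n.+1 x @[n --> \oo] -->
    c * T t u x + T t v x.
  apply: cvgD; last exact: cvg_euler_approx vB Ax.
  by apply: cvgM; [exact: cvg_cst|exact: cvg_euler_approx uB Ax].
apply: cvg_trans; apply: near_eq_cvg; near=> n.
rewrite /euler_approx (iter_euler_linear _ _ _ _ uB vB Ax)//; first exact: divr_ge0.
rewrite mulrAC ler_pdivrMr// mul1r.
by near: n; exact: near_ge_natr.
Unshelve. all: by end_near. Qed.

Lemma jump_semigroup_local t u B x : 0 <= t -> bounded_on A u B -> A x ->
  `|T t u x - euler_step t u x| <= K B * t ^+ 2.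
Proof.
move=> t0 uB Ax.
apply: (@cvgr_to_le _ (\oo : set_system nat) _ R
   (fun n => `|euler_approx t u n.+1 x - euler_step t u x|)).
  by apply: cvg_norm; apply: cvgB; [exact: cvg_euler_approx uB Ax|exact: cvg_cst].
near=> n; rewrite /euler_approx.
have {2}-> : t = n.+1%:R * (t / n.+1%:R) by rewrite mulrC divfK.
have -> : K B * t ^+ 2 = 2 * lam ^+ 2 * (n.+1%:R * (t / n.+1%:R)) ^+ 2 * B.
  by rewrite [_ * (t / _)]mulrC divfK//; ring.
apply: iter_euler_local => //; first exact: divr_ge0.
rewrite mulrAC ler_pdivrMr// mul1r.
by near: n; exact: near_ge_natr.
Unshelve. all: by end_near. Qed.

Lemma jump_semigroup0 u B x : bounded_on A u B -> A x -> T 0 u x = u x.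
Proof.
move=> uB Ax; have := jump_semigroup_local (lexx 0) uB Ax.
by rewrite expr0n mulr0 normr_le0 subr_eq0 /euler_step mul0r addr0 => /eqP.
Qed.

(** Compare two Euler schemes with the same number of steps and different step sizes. *)
Lemma jump_semigroup_time_lipschitz s t u B x : 0 <= s -> 0 <= t ->
  bounded_on A u B -> A x -> `|T s u x - T t u x| <= `|s - t| * (2 * B * lam).
Proof.
move=> s0 t0 uB Ax.
apply: (@cvgr_to_le _ (\oo : set_system nat) _ R
   (fun n => `|euler_approx s u n.+1 x - euler_approx t u n.+1 x|)).
  by apply: cvg_norm; apply: cvgB; exact: cvg_euler_approx uB Ax.
near=> n.
have sn : s / n.+1%:R * lam <= 1.
  by rewrite mulrAC ler_pdivrMr// mul1r; near: n; exact: near_ge_natr.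
have tn : t / n.+1%:R * lam <= 1.
  by rewrite mulrAC ler_pdivrMr// mul1r; near: n; exact: near_ge_natr.
pose v_ j := iter j (euler_step (s / n.+1%:R)) u.
have vB j : bounded_on A (v_ j) B.
  by apply: bounded_on_iter_euler => //; exact: divr_ge0.
apply: le_trans (@euler_stable (t / n.+1%:R) v_
  (`|s - t| / n.+1%:R * (2 * B * lam)) B n.+1 _ tn vB _ x Ax) _.
- exact: divr_ge0.
- move=> j y _ Ay; rewrite /v_ iterS -/(v_ j) /euler_step opprD addrACA subrr add0r.
  rewrite -mulrBl -mulrBl !normrM normfV (ger0_norm (ler0n R n.+1)).
  by rewrite ler_wpM2l ?divr_ge0//; exact: bounded_on_jump_gen.
- by rewrite [(`|_ - _| / _)]mulrC !mulrA mulfV// mul1r.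
Unshelve. all: by end_near. Qed.

Let iter_euler_grid h u B k x : 0 <= h -> h * lam <= 1 -> bounded_on A u B -> A x ->
  `|iter k (euler_step h) u x - T (k%:R * h) u x| <= K B * (k%:R * h) * h.
Proof.
move=> h0 hlam uB Ax; case: k => [|k].
  by rewrite !mul0r (jump_semigroup0 uB)// subrr normr0 mulr0 mul0r.
have kh : k.+1%:R * h / k.+1%:R = h by rewrite mulrAC mulfV// mul1r.
have := @jump_semigroup_rate (k.+1%:R * h) u B k x.
rewrite distrC /euler_approx kh => /(_ _ _ uB Ax) H.
apply: le_trans (H _ _) _; first exact: mulr_ge0.
  by rewrite -mulrA ler_piMr.
by rewrite expr2 (mulrA _ (_ * h)) -(mulrA _ (_ * h)) kh.
Qed.

(** Both factors are approximated on a common grid of step [h = (s + t) / n], which need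
    not contain [s]: moving [s] to the grid costs O(h) by Lipschitz continuity in time. *)
Lemma jump_semigroupD s t u B x : 0 <= s -> 0 <= t -> bounded_on A u B -> A x ->
  T (s + t) u x = T s (T t u) x.
Proof.
move=> s0 t0 uB Ax.
have TB := bounded_on_jump_semigroup t0 uB.
have B0 := bounded_on_ge0 Ax uB.
have [st0|st0] := eqVneq (s + t) 0.
  have -> : s = 0 by lra.
  by rewrite add0r (jump_semigroup0 TB).
have {}st0 : 0 < s + t by rewrite lt_neqAle eq_sym st0 addr_ge0.
pose c := K B * (s + t) ^+ 2 + 2 * (K B * (s + t) + 2 * B * lam) * (s + t).
apply/eqP; rewrite -subr_eq0 -normr_le0.
apply: (@cvgr_to_ge _ (\oo : set_system nat) _ R (fun n => c / n.+1%:R)).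
  exact: cvg_divSn.
near=> n.
have stn : (s + t) * lam <= n.+1%:R by near: n; exact: near_ge_natr.
pose h := (s + t) / n.+1%:R.
have h0 : 0 < h by exact: divr_gt0.
have hlam : h * lam <= 1 by rewrite mulrAC ler_pdivrMr// mul1r.
have nh : n.+1%:R * h = s + t by rewrite mulrC divfK.
pose k := Num.truncn (s / h).
have [ks sk] : k%:R * h <= s /\ s <= k%:R * h + h.
  have /andP[] : k%:R <= s / h < k.+1%:R by apply: truncn_itv; rewrite divr_ge0// ltW.
  rewrite ler_pdivlMr// ltr_pdivrMr// -natr1 mulrDl mul1r => ? /ltW ?.
  by [].
have kn : (k <= n.+1)%N.
  by rewrite -(ler_nat R) -(ler_pM2r h0) nh (le_trans ks)// lerDl.
pose l := (n.+1 - k)%N.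
have lh : l%:R * h = s + t - k%:R * h by rewrite natrB// mulrBl nh.
have grid w j r0 y : bounded_on A w B -> A y -> 0 <= r0 -> `|j%:R * h - r0| <= h ->
    (j <= n.+1)%N -> `|iter j (euler_step h) w y - T r0 w y| <= (K B * (s + t) + 2 * B * lam) * h.
  move=> wB Ay r00 jr jn.
  have jh0 : 0 <= j%:R * h by rewrite mulr_ge0// ltW.
  apply: le_trans (ler_distD (T (j%:R * h) w y) _ _) _; rewrite mulrDl lerD//.
    apply: le_trans (iter_euler_grid _ (ltW h0) hlam wB Ay) _.
    rewrite ler_wpM2r ?(ltW h0)// ler_wpM2l ?mulr_ge0 ?exprn_ge0//.
    by rewrite -nh ler_wpM2r ?(ltW h0)// ler_nat.
  apply: le_trans (jump_semigroup_time_lipschitz jh0 r00 wB Ay) _.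
  by rewrite mulrC ler_wpM2l// !mulr_ge0.
have -> : T (s + t) u x - T s (T t u) x =
   (T (s + t) u x - euler_approx (s + t) u n.+1 x) +
   (iter k (euler_step h) (fun y => iter l (euler_step h) u y - T t u y) x +
   (iter k (euler_step h) (T t u) x - T s (T t u) x)).
  have itB := bounded_on_iter_euler l (ltW h0) hlam uB.
  have -> : (fun y => iter l (euler_step h) u y - T t u y) =
     (fun y => -1 * T t u y + iter l (euler_step h) u y).
    by apply/funext => y; ring.
  rewrite (iter_euler_linear _ _ (ltW h0) hlam TB itB Ax) -iterD subnKC//.
  by rewrite /euler_approx -/h; ring.
rewrite /c mulrDl; apply: le_trans (ler_normD _ _) _; apply: lerD.
  exact: jump_semigroup_rate (ltW st0) stn uB Ax.
rewrite -[X in _ <= X]mulrA -/h -mulrA mulr_natl mulr2n.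
apply: le_trans (ler_normD _ _) _; apply: lerD; last first.
  by apply: grid => //; rewrite ler_norml; lra.
apply: (bounded_on_iter_euler k (ltW h0) hlam _ Ax) => y Ay.
by apply: grid => //; [rewrite ler_norml lh; lra|rewrite leq_subr].
Unshelve. all: by end_near. Qed.

(** Dominated convergence for the sums over jumps gives the claim for each Euler scheme;
    the schemes converge uniformly over functions with a common bound. *)
Lemma jump_semigroup_dominated_cvg0 t (u_ : nat -> E -> R) B : 0 <= t ->
  (forall k, bounded_on A (u_ k) B) ->
  (forall x, A x -> u_ k x @[k --> \oo] --> 0) ->
  forall x, A x -> T t (u_ k) x @[k --> \oo] --> 0.
Proof.
move=> t0 uB u0 x Ax.
have euler_cvg0 h (v_ : nat -> E -> R) : (forall k, bounded_on A (v_ k) B) ->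
    (forall x, A x -> v_ k x @[k --> \oo] --> 0) ->
    forall x, A x -> euler_step h (v_ k) x @[k --> \oo] --> 0.
  move=> vB v0 y Ay; rewrite -[X in _ --> X](addr0 0).
  apply: cvgD; first exact: v0.
  rewrite -[X in _ --> X](mulr0 h); apply: cvgM; first exact: cvg_cst.
  rewrite -[X in _ --> X](jump_gen_cst 0 y).
  apply: (rsum_dominated_cvg (g := fun i => 2 * B * r y i)).
  - by move=> k i Di; exact: jump_term_le.
  - by apply: le_lt_trans (jump_term_esum _ Ay) (ltry _); exact: bounded_on_ge0 Ay (vB 0%N).
  - move=> i Di; apply: cvgM; first exact: cvg_cst.
    by apply: cvgB; apply: v0 => //; exact: A_closed.
have iter_cvg0 h n : 0 <= h -> h * lam <= 1 -> forall y, A y ->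
    iter n (euler_step h) (u_ k) y @[k --> \oo] --> 0.
  move=> h0 hlam; elim: n => // n IHn y Ay.
  apply: (euler_cvg0 h (fun k => iter n (euler_step h) (u_ k))) => // k.
  exact: bounded_on_iter_euler.
apply/cvgrPdist_lt => e e0.
have e2 : 0 < e / 2 by rewrite divr_gt0.
have [n [tn en]] : exists n, t * lam <= n.+1%:R /\ K B * t ^+ 2 / n.+1%:R < e / 2.
  have : \forall n \near \oo, t * lam <= n.+1%:R /\ K B * t ^+ 2 / n.+1%:R < e / 2.
    near=> n; split; first by near: n; exact: near_ge_natr.
    near: n; have /cvgrPdist_lt/(_ _ e2) := cvg_divSn (K B * t ^+ 2).
    by apply: filterS => n; rewrite sub0r normrN => /(le_lt_trans (ler_norm _)).
  by move=> /filter_ex.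
have := iter_cvg0 (t / n.+1%:R) n.+1 _ _ x Ax.
rewrite divr_ge0// mulrAC ler_pdivrMr// mul1r => /(_ isT tn) /cvgrPdist_lt/(_ _ e2).
apply: filterS => k; rewrite !sub0r !normrN => ek.
rewrite [ltRHS]splitr -[T _ _ _](subrK (euler_approx t (u_ k) n.+1 x)).
apply: le_lt_trans (ler_normD _ _) (ltrD _ ek).
exact: le_lt_trans (jump_semigroup_rate t0 tn (uB k) Ax) en.
Unshelve. all: by end_near. Qed.

(** Forwards in time this is the local estimate and the semigroup property. Backwards, the
    expansion is taken at the earlier time, and moving [Q (T s u)] between the two times
    costs twice the same constant. *)
Lemma jump_semigroup_taylor s s' u B x : 0 <= s -> 0 <= s' -> bounded_on A u B -> A x ->
  `|T s' u x - T s u x - (s' - s) * Q (T s u) x| <= 3 * K B * (s' - s) ^+ 2.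
Proof.
move=> s0 s0' uB Ax.
have B0 := bounded_on_ge0 Ax uB.
have KB0 : 0 <= K B * (s' - s) ^+ 2 by rewrite mulr_ge0 ?sqr_ge0// mulr_ge0// mulr_ge0 ?sqr_ge0.
have forward r0 h : 0 <= r0 -> 0 <= h ->
    `|T (h + r0) u x - T r0 u x - h * Q (T r0 u) x| <= K B * h ^+ 2.
  move=> r00 h0; rewrite (jump_semigroupD h0 r00 uB Ax) -addrA -opprD.
  exact: jump_semigroup_local (bounded_on_jump_semigroup r00 uB) Ax.
have [ss'|s's] := leP s s'.
  have := forward s (s' - s) s0; rewrite subrK subr_ge0 => /(_ ss') H.
  by apply: le_trans H _; rewrite -[leRHS]mulrA ler_peMl// ler1n.
have := forward s' (s - s') s0'; rewrite subrK subr_ge0 => /(_ (ltW s's)) H.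
have QQ : `|Q (T s u) x - Q (T s' u) x| <= 2 * ((s - s') * (2 * B * lam)) * lam.
  rewrite -(jump_genB (bounded_on_jump_semigroup s0 uB) (bounded_on_jump_semigroup s0' uB) Ax).
  apply: (bounded_on_jump_gen _ Ax) => y Ay.
  have := jump_semigroup_time_lipschitz s0 s0' uB Ay.
  by rewrite (gtr0_norm (x := s - s')) ?subr_gt0.
have regroup (c c' d d' : R) : c' - c - (s' - s) * d =
    - (c - c' - (s - s') * d') + (s - s') * (d - d') by ring.
rewrite (regroup _ _ _ (Q (T s' u) x)); apply: le_trans (ler_normD _ _) _.
rewrite normrN normrM gtr0_norm ?subr_gt0//.
have ss0 : 0 <= s - s' by rewrite subr_ge0 ltW.
apply: le_trans (lerD H (ler_wpM2l ss0 QQ)) _.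
by rewrite le_eqVlt; apply/orP; left; apply/eqP; ring.
Qed.

End bounded_rates.
End jump_operator.
(** * The transition function of a countable jump chain *)

Section intertwining.
Context {R : realType} {E F : Type} {I : choiceType}.
Variables (D : set I) (r : E -> I -> R) (m : E -> I -> E) (m' : F -> I -> F) (phi : F -> E).
Hypothesis phim : forall x i, phi (m' x i) = m (phi x) i.

Lemma jump_semigroup_comp t u x :
  jump_semigroup D r m t u (phi x) = jump_semigroup D (r \o phi) m' t (u \o phi) x.
Proof.
have it h n v : iter n (euler_step D r m h) v \o phi = iter n (euler_step D (r \o phi) m' h) (v \o phi).
  elim: n => //= n <-; apply/funext => y; rewrite /euler_step /jump_gen /=; congr (_ + h * _).
  by apply: eq_rsum => i _; rewrite /= phim.
rewrite /jump_semigroup; congr (lim (_ @ \oo)); apply/funext => n.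
by rewrite /euler_approx -it.
Qed.

End intertwining.

Section countable_chain.
Context {R : realType} {E I : choiceType}.
Variables (D : set I) (r : E -> I -> R) (m : E -> I -> E).
Variables (code : E -> nat) (A : nat -> set E) (lam : nat -> R).
Hypothesis code_inj : injective code.
Hypothesis Arates : forall N, bounded_rates D r m (A N) (lam N).
Hypothesis A_exhausts : forall x, exists N, A N x.
Implicit Types (x y z : E) (u v w : E -> R) (s t h : R).

Local Notation Q := (jump_gen D r m).
Local Notation T := (jump_semigroup D r m).

Let r_ge0 x i : 0 <= r x i. Proof. by case: (Arates 0%N). Qed.

Definition point_mass y : E -> R := fun x => (x == y)%:R.
Definition jump_chain t x y : R := T t (point_mass y) x.
Definition jump_intensity x y : \bar R :=
  (\esum_(i in [set i | D i /\ m x i = y]) (r x i)%:E)%E.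

Definition locally_bounded u := forall N, exists B, bounded_on (A N) u B.

Lemma point_mass_bounded y (X : set E) : bounded_on X (point_mass y) 1.
Proof. by move=> x _; rewrite /point_mass; case: eqP => _; rewrite ?normr1 ?normr0. Qed.

Lemma jump_chain_ge0 t x y : 0 <= t -> 0 <= jump_chain t x y.
Proof.
move=> t0; have [N AN] := A_exhausts x.
exact: (jump_semigroup_ge0 (Arates N) t0 (@point_mass_bounded y _)).
Qed.

Lemma jump_semigroup_sum t u (l : seq E) x : 0 <= t ->
  T t (fun z => \sum_(y <- l) u y * point_mass y z) x = \sum_(y <- l) u y * jump_chain t x y.
Proof.
move=> t0; have [N AN] := A_exhausts x.
elim: l => [|y l IHl].
  rewrite big_nil -[RHS](jump_semigroup_cst D r m t (0 : R) x).
  by congr (T t _ x); apply/funext => z; rewrite big_nil.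
rewrite big_cons -IHl.
under [in LHS]eq_fun do rewrite big_cons.
apply: (jump_semigroup_linear (Arates N) _ t0 (@point_mass_bounded y _)
  (B' := \sum_(y <- l) `|u y|) _ AN) => z _.
apply: le_trans (ler_norm_sum _ _ _) _; apply: ler_sum => k _.
rewrite normrM ler_piMr//; exact: (@point_mass_bounded k setT).
Qed.

(** Over finitely many states this is linearity; dominated continuity of the semigroup
    gives the rest of the sum, through an enumeration of the states. *)
Lemma jump_chain_sum t u x : 0 <= t -> (forall y, 0 <= u y) -> locally_bounded u ->
  (\esum_(y in setT) (jump_chain t x y * u y)%:E = (T t u x)%:E)%E.
Proof.
move=> t0 u0 ub; have [N AN] := A_exhausts x; have [B uB] := ub N.
have le_T : (\esum_(y in setT) (jump_chain t x y * u y)%:E <= (T t u x)%:E)%E.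
  apply: ge_ereal_sup => _ [J [Jfin _] <-].
  rewrite fsumEFin// lee_fin fsbig_finite//=.
  under eq_bigr do rewrite mulrC.
  rewrite -jump_semigroup_sum// -subr_ge0.
  set v := (X in T t u x - T t X x).
  have vE z : v z = (z \in J)%:R * u z.
    rewrite /v -fsbig_finite//=; have [zJ|zJ] := boolP (z \in J).
      rewrite (fsbigD1 z)//=; last by rewrite inE in zJ.
      rewrite /point_mass eqxx mulr1 mul1r fsbig1 ?addr0// => y [_ /= yz].
      by rewrite eq_sym; case: eqP yz => // _ _; rewrite mulr0.
    rewrite mul0r fsbig1// => y yJ; rewrite /point_mass; case: eqP => [zy|]; last by rewrite mulr0.
    by move: zJ; rewrite zy mem_set.
  have vB : bounded_on (A N) v B.
    move=> z Az; rewrite vE; apply: le_trans (uB _ Az).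
    by rewrite normrM ler_piMl//; case: (z \in J); rewrite ?normr1 ?normr0.
  have -> : T t u x - T t v x = T t (fun y => -1 * v y + u y) x.
    by rewrite (jump_semigroup_linear (Arates N) _ t0 vB uB AN); ring.
  apply: (jump_semigroup_ge0 (Arates N) t0 (bounded_on_lin (-1) vB uB) _ AN) => z Az.
  by rewrite vE; case: (z \in J); have := u0 z; rewrite ?mul1r ?mul0r; lra.
apply/eqP; rewrite eq_le le_T /=.
have sum0 : (0 <= \esum_(y in setT) (jump_chain t x y * u y)%:E)%E.
  by apply: esum_ge0 => y _; rewrite lee_fin mulr_ge0// jump_chain_ge0.
pose tail k z := if (code z < k)%N then 0 else u z.
have tailB k : bounded_on (A N) (tail k) B.
  move=> z Az; rewrite /tail; case: ifP => _; last exact: uB.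
  by rewrite normr0; exact: bounded_on_ge0 AN uB.
have tail0 : T t (tail k) x @[k --> \oo] --> (0 : R).
  apply: (jump_semigroup_dominated_cvg0 (Arates N) t0 tailB _ AN) => z Az.
  apply: cvg_near_cst; near=> k; rewrite /tail ifT//.
  by near: k; exact: nbhs_infty_gt.
have part k : ((T t u x - T t (tail k) x)%:E <=
    \esum_(y in setT) (jump_chain t x y * u y)%:E)%E.
  have Jfin : finite_set [set y | (code y < k)%N].
    apply: (@finite_preimage _ _ `I_k code); last exact: finite_II.
    by move=> y z _ _; exact: code_inj.
  apply: esum_ge; exists [set y | (code y < k)%N] => //.
  rewrite fsumEFin// lee_fin fsbig_finite//=.
  under eq_bigr do rewrite mulrC.
  rewrite -jump_semigroup_sum//.
  have -> : T t u x - T t (tail k) x = T t (fun y => -1 * tail k y + u y) x.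
    by rewrite (jump_semigroup_linear (Arates N) _ t0 (tailB k) uB AN); ring.
  rewrite le_eqVlt; apply/orP; left; apply/eqP; congr (T t _ x); apply/funext => z.
  rewrite -fsbig_finite//= /tail; case: ifPn => zk.
    rewrite (fsbigD1 z)//= /point_mass eqxx mulr1 fsbig1 ?addr0 ?mulr0 ?add0r// => y [_ /= yz].
    by rewrite eq_sym; case: eqP yz => // _ _; rewrite mulr0.
  rewrite fsbig1 ?mulN1r ?addNr// => y /= yk; rewrite /point_mass.
  by case: eqP => [zy|]; rewrite ?mulr0//; move: zk; rewrite zy yk.
move: le_T sum0 part; case: (\esum_(y in setT) _)%E => [S| |]//= _ _ part.
rewrite lee_fin; apply: (@ler_cvg_to _ (\oo : set_system nat) _ R
  (fun k => T t u x - T t (tail k) x) (fun=> S)).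
- by rewrite -[X in _ --> X]subr0; apply: cvgB => //; exact: cvg_cst.
- exact: cvg_cst.
- by apply: nearW => k; rewrite -lee_fin part.
Unshelve. all: by end_near. Qed.

Lemma jump_chain_transition : transition_function jump_chain.
Proof.
have cB (c : R) : locally_bounded (fun=> c) by move=> N; exists `|c|.
have pB y : locally_bounded (point_mass y).
  by move=> N; exists 1; exact: point_mass_bounded.
split.
- exact: jump_chain_ge0.
- move=> t x t0; rewrite -(jump_semigroup_cst D r m t (1 : R) x) -jump_chain_sum//.
  by apply: eq_esum => y _; rewrite mulr1.
- move=> x y; have [N AN] := A_exhausts x.
  exact: (jump_semigroup0 (Arates N) (@point_mass_bounded y _)).
- move=> s t x y s0 t0; have [N AN] := A_exhausts x.
  rewrite /jump_chain (jump_semigroupD (Arates N) s0 t0 (@point_mass_bounded y _) AN).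
  rewrite -jump_chain_sum//; first by move=> z; exact: jump_chain_ge0.
  move=> N'; exists 1.
  exact: (bounded_on_jump_semigroup (Arates N') t0 (@point_mass_bounded y _)).
Qed.

Lemma jump_intensityE x y :
  jump_intensity x y = (\esum_(i in D) (r x i * (m x i == y)%:R)%:E)%E.
Proof.
rewrite /jump_intensity esum_mkcond [RHS]esum_mkcond; apply: eq_esum => i _.
have [Di|Di] := boolP (i \in D).
  have [mi|mi] := eqVneq (m x i) y; last first.
    by rewrite mulr0 memNset// => -[_ /eqP]; rewrite (negPf mi).
  by rewrite mulr1 mem_set//; split=> //; rewrite inE in Di.
by rewrite memNset// => -[/mem_set]; rewrite (negPf Di).
Qed.

Lemma jump_intensity_ge0 x y : (0 <= jump_intensity x y)%E.
Proof. by apply: esum_ge0 => i _; rewrite lee_fin. Qed.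

Lemma esum_jump_intensity x w : (forall y, 0 <= w y) ->
  (\esum_(i in D) (r x i * w (m x i))%:E =
   \esum_(y in setT) (jump_intensity x y * (w y)%:E))%E.
Proof.
move=> w0.
transitivity (\esum_(i in D) \esum_(y in setT) (r x i * (m x i == y)%:R * w y)%:E)%E.
  apply: eq_esum => i _; under eq_esum do rewrite -mulrA.
  rewrite esumZl//; last by move=> y _; rewrite mulr_ge0.
  by rewrite esum_point// EFinM.
rewrite esum_exchange; last by move=> i y _ _; rewrite lee_fin !mulr_ge0.
apply: eq_esum => y _; rewrite jump_intensityE muleC -esumZl//; last first.
  by move=> i _; rewrite mulr_ge0.
by apply: eq_esum => i _; rewrite mulrC.
Qed.

(** Jumps that do not move leave the generator unchanged, hence the restriction to the
    targets [y != x]. *)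
Definition away x w y : R := (y != x)%:R * w y.

Let away_ge0 x w y : (forall y, 0 <= w y) -> 0 <= away x w y.
Proof. by move=> w0; rewrite mulr_ge0. Qed.

Definition jump_mass x w : R := rsum D (fun i => r x i * away x w (m x i)).

Let jump_mass_summ x w : (forall y, 0 <= w y <= 1) ->
  summable D (EFin \o (fun i => r x i * away x w (m x i))).
Proof.
move=> w01; have [N AN] := A_exhausts x; have [_ _ _ rl] := Arates N.
apply: (summ_le (g := r x)); last exact: le_lt_trans (rl _ AN) (ltry _).
move=> i Di; have /andP[w0 w1] := w01 (m x i).
rewrite ger0_norm ?mulr_ge0//; rewrite ler_piMr//.
by rewrite /away; case: eqP => _; rewrite ?mul0r ?mul1r.
Qed.

Lemma jump_massE x w : (forall y, 0 <= w y <= 1) ->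
  ((jump_mass x w)%:E = \esum_(y in setT) (jump_intensity x y * (away x w y)%:E))%E.
Proof.
move=> w01; have w0 y : 0 <= w y by have /andP[] := w01 y.
rewrite -esum_jump_intensity; last by move=> y; exact: away_ge0.
by rewrite rsum_ge0E//; [move=> i _; rewrite mulr_ge0// away_ge0|exact: jump_mass_summ].
Qed.

Lemma jump_mass_le N x w : A N x -> (forall y, 0 <= w y <= 1) -> jump_mass x w <= lam N.
Proof.
move=> AN w01; have w0 y : 0 <= w y by have /andP[] := w01 y.
have [_ _ _ rl] := Arates N.
rewrite -lee_fin rsum_ge0E//; last exact: jump_mass_summ.
  apply: le_trans (rl _ AN); apply: le_esum => i _; rewrite lee_fin ler_piMr//.
  have /andP[_ w1] := w01 (m x i).
  by rewrite /away; case: eqP => _; rewrite ?mul0r ?mul1r.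
by move=> i _; rewrite mulr_ge0// away_ge0.
Qed.

Lemma jump_genE x w : (forall y, 0 <= w y <= 1) ->
  Q w x = jump_mass x w - w x * jump_mass x (fun=> 1).
Proof.
move=> w01; rewrite /jump_mass -rsumZ; last first.
  by apply: jump_mass_summ => y; rewrite ler01 lexx.
rewrite -rsumB; last 2 first.
- exact: jump_mass_summ.
- by apply: summZ; apply: jump_mass_summ => y; rewrite ler01 lexx.
apply: eq_rsum => i _; rewrite /away; have [->|mi] := eqVneq (m x i) x; first by rewrite subrr; ring.
by rewrite /=; ring.
Qed.

Lemma exit_rateE x :
  (\esum_(y in [set y | y != x]) jump_intensity x y = (jump_mass x (fun=> 1))%:E)%E.
Proof.
rewrite jump_massE; last by move=> y; rewrite ler01 lexx.
rewrite esum_mkcond; apply: eq_esum => y _; rewrite /away.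
have [->|yx] := eqVneq y x; first by rewrite memNset ?mul0r ?mule0//= eqxx.
by rewrite mem_set//= mulr1 mule1.
Qed.

Let indic01 y x : 0 <= point_mass y x <= 1.
Proof. by rewrite /point_mass; case: eqP => _; rewrite ?lexx ?ler01. Qed.

Let one01 (y : E) : 0 <= (fun=> 1 : R) y <= 1. Proof. by rewrite ler01 lexx. Qed.

Let bounded01 (X : set E) w : (forall y, 0 <= w y <= 1) -> bounded_on X w 1.
Proof. by move=> w01 y _; have /andP[w0 w1] := w01 y; rewrite ger0_norm. Qed.

(** Applied to a point mass this gives the rate of jumping to another state, and to the
    complement of the point mass at [x], the rate of leaving [x]. *)
Lemma jump_semigroup_derive0 x w : (forall y, 0 <= w y <= 1) -> w x = 0 ->
  T h w x / h @[h --> 0^'+] --> jump_mass x w.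
Proof.
move=> w01 wx0; have [N AN] := A_exhausts x.
have wB := @bounded01 (A N) _ w01.
pose K := 2 * lam N ^+ 2 * 1.
have K0 : 0 <= K by rewrite /K mulr1 mulr_ge0// sqr_ge0.
apply/cvgrPdist_le => e e0; near=> h.
have h0 : 0 < h by near: h; exact: nbhs_right_gt.
have he : h <= e / (K + 1).
  by near: h; apply: nbhs_right_le; rewrite divr_gt0// ltr_wpDl.
have := jump_semigroup_local (Arates N) (ltW h0) wB AN; rewrite -/K.
rewrite /euler_step wx0 add0r (jump_genE _ w01) wx0 mul0r subr0 => H.
rewrite distrC.
have -> : T h w x / h - jump_mass x w = (T h w x - h * jump_mass x w) / h.
  by rewrite mulrBl [h * _]mulrC mulfK// gt_eqF.
rewrite normrM normfV (gtr0_norm h0) ler_pdivrMr//; apply: le_trans H _.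
rewrite expr2 (mulrA K) ler_wpM2r ?(ltW h0)//; move: he; rewrite ler_pdivlMr ?ltr_wpDl//.
by rewrite mulrDr mulr1; apply: le_trans; rewrite mulrC lerDl ltW.
Unshelve. all: by end_near. Qed.

Lemma jump_intensity_mass x y : x != y -> jump_intensity x y = (jump_mass x (point_mass y))%:E.
Proof.
move=> xy; rewrite jump_massE//.
rewrite -[LHS](esum_set1 (t := y) (a := jump_intensity x)) ?jump_intensity_ge0//.
rewrite esum_mkcond; apply: eq_esum => z _; rewrite /away /point_mass.
have [->|zy] := eqVneq z y; first by rewrite mem_set// eq_sym xy mulr1 mule1.
by rewrite mulr0 mule0 memNset//; exact/eqP.
Qed.

Lemma jump_chain_rates : has_jump_rates jump_chain jump_intensity.
Proof.
split=> [x y xy|x].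
  have wx0 : point_mass y x = 0 by rewrite /point_mass (negPf xy).
  rewrite jump_intensity_mass//.
  by apply: cvg_EFin; [exact: nearW|exact: jump_semigroup_derive0].
pose w y : R := (y != x)%:R.
have w01 y : 0 <= w y <= 1 by rewrite /w; case: (y != x); rewrite ?lexx ?ler01.
have wx0 : w x = 0 by rewrite /w eqxx.
have [N AN] := A_exhausts x.
rewrite exit_rateE.
have -> : jump_mass x (fun=> 1) = jump_mass x w.
  by apply: eq_rsum => i _; rewrite /away /w; case: (_ != x); rewrite ?mul0r ?mulr1.
apply: cvg_EFin; first exact: nearW.
apply: cvg_trans (jump_semigroup_derive0 w01 wx0); apply: near_eq_cvg; near=> h.
have h0 : 0 < h by near: h; exact: nbhs_right_gt.
rewrite /= /jump_chain -{1}(jump_semigroup_cst D r m h (1 : R) x); congr (_ / h).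
have -> : w = fun y => -1 * point_mass x y + 1.
  by apply/funext => y; rewrite /w /point_mass; case: eqP => _ /=; ring.
rewrite (jump_semigroup_linear (Arates N) _ (ltW h0) (@point_mass_bounded x _)
  (bounded01 one01) AN).
by ring.
Unshelve. all: by end_near. Qed.

Section uniqueness.
Variable P : R -> E -> E -> R.
Hypothesis Ptrans : transition_function P.
Hypothesis Prates : has_jump_rates P jump_intensity.

Let P_ge0 t x y : 0 <= t -> 0 <= P t x y. Proof. exact: transition_ge0. Qed.

Let P_le1 t x y : 0 <= t -> P t x y <= 1.
Proof.
move=> t0; rewrite -lee_fin -(transition_sum1 Ptrans x t0).
by apply: (@le_esum_term _ _ setT (P t x)) => // z _; exact: P_ge0.
Qed.

Let P_path s t x y z : 0 <= s -> 0 <= t -> P s x z * P t z y <= P (s + t) x y.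
Proof.
move=> s0 t0; rewrite -lee_fin (transitionD Ptrans)//.
by apply: (@le_esum_term _ _ setT (fun z => P s x z * P t z y)) => // w _; rewrite mulr_ge0// P_ge0.
Qed.

Let P_path2 s t x y : x != y -> 0 <= s -> 0 <= t ->
  P s x x * P t x y + P s x y * P t y y <= P (s + t) x y.
Proof.
move=> xy s0 t0; rewrite -lee_fin (transitionD Ptrans)//.
have f0 z : 0 <= P s x z * P t z y by rewrite mulr_ge0// P_ge0.
apply: (@le_trans _ _ (\esum_(z in setT)
   ((x == z)%:R * (P s x z * P t z y) + (y == z)%:R * (P s x z * P t z y))%:E)%E).
  rewrite esum_addr; [|by move=> z _; rewrite mulr_ge0..].
  by rewrite !esum_point// -EFinD.
apply: le_esum => z _; rewrite lee_fin -mulrDl ler_piMl//.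
by have [<-|xz] := eqVneq x z; [rewrite eq_sym (negPf xy) addr0|rewrite add0r; case: (y == z)].
Qed.

(** Not to be at [x] after [n] steps requires having left it during one of them. *)
Let stay_ge n h x : 0 <= h -> 1 - n%:R * (1 - P h x x) <= P (n%:R * h) x x.
Proof.
move=> h0; elim: n => [|n IHn]; first by rewrite !mul0r subr0 (transition0 Ptrans) eqxx.
have nh0 : 0 <= n%:R * h by rewrite mulr_ge0.
rewrite (_ : n.+1%:R * h = h + n%:R * h); last by rewrite -natr1 mulrDl mul1r addrC.
apply: le_trans (P_path x x x h0 nh0); rewrite -natr1.
have := P_le1 x x nh0; have := P_le1 x x h0; have := P_ge0 x x h0; have := P_ge0 x x nh0.
move: IHn; move: (n%:R) => N; move: (P (N * h) x x) (P h x x) => c d IHn c0 d0 d1 c1.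
nra.
Qed.

Let exit_cvg x : (1 - P h x x) / h @[h --> 0^'+] --> jump_mass x (fun=> 1).
Proof. by have := Prates.2 x; rewrite exit_rateE => /fine_cvg. Qed.

(** Let the number of steps in [stay_ge] go to infinity: the pointwise derivative at zero
    becomes a bound valid for all times. *)
Let leave_le t x : 0 <= t -> 1 - P t x x <= t * jump_mass x (fun=> 1).
Proof.
rewrite le_eqVlt => /orP[/eqP <-|t0].
  by rewrite (transition0 Ptrans) eqxx subrr mul0r.
apply: (@cvgr_to_ge _ (\oo : set_system nat) _ R
  (fun n => t * ((1 - P (t / n.+1%:R) x x) / (t / n.+1%:R)))).
  by apply: cvgM; [exact: cvg_cst|exact: (cvg_comp _ _ (cvg_divSn_at_right t0) (@exit_cvg x))].
apply: nearW => n.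
have h0 : 0 <= t / n.+1%:R by rewrite divr_ge0// ltW.
have := stay_ge n.+1 x h0; rewrite [_ * (t / _)]mulrC divfK// => H.
have alg (q b : R) : b != 0 -> t * (q / (t / b)) = b * q.
  by move=> b0; field; rewrite b0 gt_eqF.
rewrite alg//; lra.
Qed.

(** Split according to the first step: either [x] is kept, or [y] is reached and then kept.
    Iterating counts the paths that stay at [x], jump to [y] once, and are found at [y]. *)
Let jump_ge n h x y e : 0 <= h -> x != y -> 0 <= e ->
  1 - P h x x <= e -> (forall k, 1 - P (k%:R * h) y y <= k%:R * e) ->
  n%:R * P h x y * (1 - n%:R * e) <= P (n%:R * h) x y.
Proof.
move=> h0 xy e0 xe ye; elim: n => [|n IHn]; first by rewrite !mul0r P_ge0.
have nh0 : 0 <= n%:R * h by rewrite mulr_ge0.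
rewrite (_ : n.+1%:R * h = h + n%:R * h); last by rewrite -natr1 mulrDl mul1r addrC.
apply: le_trans (P_path2 xy h0 nh0); rewrite -natr1.
have := ye n; have := P_ge0 x y nh0; have := P_ge0 y y nh0.
have := P_ge0 x x h0; have := P_ge0 x y h0.
move: IHn xe; move: (P (_ * h) x y) (P (_ * h) y y) (P h x x) (P h x y) => c d k q.
move=> IHn xe q0 k0 d0 c0 ye'; have := ler0n R n.
move: (n%:R) IHn ye' => N IHn ye' N0.
have [big|small] := leP (1 - (N + 1) * e) 0.
  have := mulr_ge0 k0 c0; have := mulr_ge0 q0 d0.
  have : (N + 1) * q * (1 - (N + 1) * e) <= 0.
    by rewrite mulr_ge0_le0// mulr_ge0// addr_ge0.
  lra.
have Ne0 : 0 <= N * e by rewrite mulr_ge0.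
have h1 : q * (1 - N * e) <= q * d by rewrite ler_wpM2l//; lra.
have h2 : (1 - e) * (N * q * (1 - N * e)) <= k * c.
  apply: ler_pM => //; try by lra.
  by rewrite !mulr_ge0//; lra.
have h3 : 0 <= q * e * (1 + N * (N * e)) by rewrite !mulr_ge0// addr_ge0// mulr_ge0.
have -> : (N + 1) * q * (1 - (N + 1) * e) =
  (1 - e) * (N * q * (1 - N * e)) + q * (1 - N * e) - q * e * (1 + N * (N * e)) by ring.
lra.
Qed.

Let jump_to_ge N t x y : x != y -> A N x -> A N y -> 0 <= t ->
  t * jump_mass x (point_mass y) * (1 - t * lam N) <= P t x y.
Proof.
move=> xy Ax Ay; rewrite le_eqVlt => /orP[/eqP <-|t0]; first by rewrite !mul0r P_ge0.
have [_ lam0 _ _] := Arates N.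
have J1 z : A N z -> jump_mass z (fun=> 1) <= lam N by move=> Az; exact: jump_mass_le.
apply: (@cvgr_to_le _ (\oo : set_system nat) _ R
  (fun n => t * (P (t / n.+1%:R) x y / (t / n.+1%:R)) * (1 - t * lam N))).
  apply: cvgM; last exact: cvg_cst.
  apply: cvgM; first exact: cvg_cst.
  apply: (cvg_comp _ _ (cvg_divSn_at_right t0) (_ : P h x y / h @[h --> 0^'+] --> _)).
  by have := Prates.1 x y xy; rewrite jump_intensity_mass// => /fine_cvg.
apply: nearW => n; set h := t / n.+1%:R.
have h0 : 0 <= h by rewrite divr_ge0// ltW.
have nh : n.+1%:R * h = t by rewrite /h mulrC divfK.
have := @jump_ge n.+1 h x y (h * lam N) h0 xy (mulr_ge0 h0 lam0) _ _.
rewrite nh => H; rewrite [leLHS](_ : _ = n.+1%:R * P h x y * (1 - n.+1%:R * (h * lam N))).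
  apply: H; first by apply: le_trans (leave_le _ h0) _; rewrite ler_wpM2l// J1.
  move=> k; rewrite (mulrA _ h); have kh0 : 0 <= k%:R * h by rewrite mulr_ge0.
  by apply: le_trans (leave_le _ kh0) _; rewrite ler_wpM2l// J1.
rewrite (mulrA _ h) nh; congr (_ * _).
have alg (q b c : R) : b != 0 -> c * b * (q / b) = c * q by move=> b0; field.
by rewrite -[X in X * (_ / _)]nh alg// gt_eqF// divr_gt0.
Qed.

Let jump_mass_out N x y : A N x -> ~ A N y -> jump_mass x (point_mass y) = 0.
Proof.
move=> Ax Ay; have [_ _ Acl _] := Arates N.
rewrite /jump_mass (eq_rsum (g := fun=> 0 - 0)); last first.
  move=> i Di; rewrite subr0 /away /point_mass.
  case: (m x i =P y) => [miy|]; last by rewrite !mulr0.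
  by exfalso; apply: Ay; rewrite -miy; exact: Acl.
by rewrite rsum_sub ?subrr//; exact: summ0.
Qed.

(** Each entry of [P h] is at least that of the Euler step, up to O(h^2): the diagonal by
    [leave_le], the others by [jump_to_ge] when [y] is in the class, and by [jump_mass_out],
    since the rate vanishes, when it is not. *)
Let P_euler_ge N h w x : A N x -> 0 <= h -> h * lam N <= 1 -> (forall y, 0 <= w y <= 1) ->
  ((euler_step D r m h w x - h ^+ 2 * lam N ^+ 2)%:E <= \esum_(y in setT) (P h x y * w y)%:E)%E.
Proof.
move=> Ax h0 hlam w01; have [_ lam0 _ _] := Arates N.
have w0 y : 0 <= w y by have /andP[] := w01 y.
pose J1 := jump_mass x (fun=> 1); pose Z := jump_mass x w.
have J1le : J1 <= lam N by exact: jump_mass_le.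
have Zle : Z <= lam N by exact: jump_mass_le.
have Z0 : 0 <= Z by apply: rsum_ge0 => i _; rewrite mulr_ge0// away_ge0.
have J10 : 0 <= J1 by apply: rsum_ge0 => i _; rewrite mulr_ge0// away_ge0.
have jm0 y : 0 <= jump_mass x (point_mass y).
  by apply: rsum_ge0 => i _; rewrite mulr_ge0// away_ge0// => z; have /andP[] := indic01 y z.
have hJ1 : 0 <= 1 - h * J1.
  by rewrite subr_ge0; apply: le_trans hlam; rewrite ler_wpM2l.
have hl : 0 <= h * (1 - h * lam N) by rewrite mulr_ge0// subr_ge0.
apply: (@le_trans _ _ (\esum_(y in setT) ((x == y)%:R * ((1 - h * J1) * w y) +
   (h * (1 - h * lam N)) * (jump_mass x (point_mass y) * away x w y))%:E)%E); last first.
  apply: le_esum => y _; rewrite lee_fin /away.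
  have [<-|xy] := eqVneq x y.
    rewrite /= mul0r !mulr0 addr0 mul1r ler_wpM2r//.
    by have := leave_le x h0; rewrite -/J1; lra.
  rewrite /= mul0r add0r mul1r mulrA ler_wpM2r//.
  have [Ay|Ay] := pselect (A N y); last by rewrite (jump_mass_out Ax Ay) mulr0 P_ge0.
  by rewrite mulrAC jump_to_ge.
rewrite esum_addr; last 2 first.
- by move=> y _; rewrite !mulr_ge0.
- by move=> y _; rewrite mulr_ge0// mulr_ge0// away_ge0.
rewrite (esum_point (F := fun y => (1 - h * J1) * w y)); last by move=> y; rewrite mulr_ge0.
rewrite esumZl//; last by move=> y _; rewrite mulr_ge0// away_ge0.
have -> : (\esum_(y in setT) (jump_mass x (point_mass y) * away x w y)%:E = Z%:E)%E.
  rewrite /Z jump_massE//; apply: eq_esum => y _; rewrite EFinM.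
  have [<-|xy] := eqVneq x y; first by rewrite /away eqxx mul0r !mule0.
  by rewrite jump_intensity_mass.
rewrite -EFinM -EFinD lee_fin /euler_step jump_genE// -/J1 -/Z.
have := ler_wpM2l lam0 Zle; have := sqr_ge0 h => hh ZZ.
have := ler_wpM2l hh ZZ; rewrite -expr2.
rewrite -subr_ge0 => ?; rewrite -subr_ge0.
rewrite [leRHS](_ : _ = h ^+ 2 * lam N ^+ 2 - h ^+ 2 * (lam N * Z)) ?expr2//; ring.
Qed.

Let P_semigroup_ge t x z : 0 <= t -> jump_chain t x z <= P t x z.
Proof.
move=> t0; have [N Ax] := A_exhausts x; have [_ lam0 _ _] := Arates N.
apply: (@ler_cvg_to _ (\oo : set_system nat) _ R
  (fun n => euler_approx D r m t (point_mass z) n.+1 x)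
  (fun n => P t x z + t ^+ 2 * lam N ^+ 2 / n.+1%:R)).
- exact: (cvg_euler_approx (Arates N) t0 (@point_mass_bounded z _) Ax).
- rewrite -[X in _ --> X]addr0; apply: cvgD; first exact: cvg_cst.
  exact: cvg_divSn.
near=> n; rewrite -lerBlDr; set h := t / n.+1%:R.
have h0 : 0 <= h by rewrite divr_ge0.
have nh : n.+1%:R * h = t by rewrite /h mulrC divfK.
have hlam : h * lam N <= 1.
  by rewrite mulrAC ler_pdivrMr// mul1r; near: n; exact: near_ge_natr.
pose v_ j y := P (j%:R * h) y z.
have jh0 j : 0 <= j%:R * h by rewrite mulr_ge0.
have v01 j y : 0 <= v_ j y <= 1 by rewrite P_ge0 ?P_le1.
have vB j : bounded_on (A N) (v_ j) 1 by exact: bounded01.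
have := @euler_stable_ge _ _ _ D r m (A N) (lam N) (Arates N) h v_
  (h ^+ 2 * lam N ^+ 2) 1 n.+1 h0 hlam vB _ x Ax.
have -> : v_ 0%N = point_mass z.
  by apply/funext => y; rewrite /v_ mul0r (transition0 Ptrans).
have -> : v_ n.+1 x = P t x z by rewrite /v_ nh.
rewrite /euler_approx -/h => H.
apply: le_trans (H _); last first.
  move=> j y Ay; rewrite -lee_fin {2}/v_.
  rewrite (_ : j.+1%:R * h = h + j%:R * h); last by rewrite -natr1 mulrDl mul1r addrC.
  by rewrite (transitionD Ptrans)//; exact: P_euler_ge.
rewrite lerB// le_eqVlt; apply/orP; left; apply/eqP.
have alg (b c d e : R) : b != 0 -> b * c = d -> b * (c ^+ 2 * e ^+ 2) = d ^+ 2 * e ^+ 2 / b.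
  by move=> b0 <-; field.
by rewrite (alg _ _ _ _ _ nh).
Unshelve. all: by end_near. Qed.

(** Both kernels have total mass one, so the domination [P_semigroup_ge] is an equality. *)
Lemma jump_chain_unique t x y : 0 <= t -> P t x y = jump_chain t x y.
Proof.
move=> t0; apply/eqP; rewrite eq_sym -subr_eq0 -normr_le0 distrC.
have d0 z : 0 <= P t x z - jump_chain t x z by rewrite subr_ge0 P_semigroup_ge.
rewrite ger0_norm// -lee_fin.
have Q0 z : 0 <= jump_chain t x z by exact: jump_chain_ge0.
have : (\esum_(z in setT) (P t x z - jump_chain t x z)%:E + 1 = 0 + 1 :> \bar R)%E.
  rewrite add0e -[X in (_ + X)%E](transition_sum1 jump_chain_transition x t0) -esum_addr//.
  rewrite -[RHS](transition_sum1 Ptrans x t0); apply: eq_esum => z _.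
  by rewrite subrK.
move=> /(congr1 (fun e => e - 1)%E); rewrite !addeK// => sum0.
have := @le_esum_term _ _ setT (fun z => P t x z - jump_chain t x z) y (fun z _ => d0 z).
by rewrite sum0; exact.
Qed.

End uniqueness.
Section expectations.
Context {d : measure_display} {Omega : measurableType d} (Pr : probability Omega R).
Local Open Scope ereal_scope.

Lemma integral_countable_valued (Y : Omega -> E) (v : E -> R) :
  (forall y, measurable [set om | Y om = y]) -> (forall y, 0 <= v y)%R ->
  \int[Pr]_om (v (Y om))%:E = \esum_(y in setT) ((v y)%:E * Pr [set om | Y om = y]).
Proof.
move=> mY v0; pose F n := [set om | code (Y om) = n].
have FE y : F (code y) = [set om | Y om = y].
  by apply/seteqP; split => om; [exact: code_inj|rewrite /F /= => ->].
have F0 n : ~ (exists y, code y = n) -> F n = set0.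
  by move=> H; apply/seteqP; split => om //= Yn; apply: H; exists (Y om).
have mF n : measurable (F n).
  by have [[y <-]|/F0 ->] := pselect (exists y, code y = n); rewrite ?FE.
have cst_on y om : F (code y) om -> (v (Y om))%:E = cst (v y)%:E om.
  by rewrite FE /= => ->.
have UF : \bigcup_n F n = setT.
  by apply/seteqP; split => om // _; exists (code (Y om)).
rewrite -UF ge0_integral_bigcup//; last 3 first.
- apply/measurable_fun_bigcup => // n.
  have [[y <-]|/F0 ->] := pselect (exists y, code y = n); last exact: measurable_fun_set0.
  apply: (eq_measurable_fun (cst (v y)%:E)); last exact: measurable_cst.
  by move=> om; rewrite inE => /cst_on ->.
- by move=> om _; rewrite lee_fin.
- by move=> i j _ _ [om [/= <- <-]].
have I0 n : 0 <= \int[Pr]_(om in F n) (v (Y om))%:E.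
  by apply: integral_ge0 => om _; rewrite lee_fin.
rewrite nneseries_esumT//.
transitivity (\esum_(n in range code) \int[Pr]_(om in F n) (v (Y om))%:E).
  rewrite [RHS]esum_mkcond; apply: eq_esum => n _; case: ifPn => // /negP H.
  rewrite F0 ?integral_set0// => -[y yn]; apply: H.
  by rewrite inE /=; exists y.
rewrite esum_image; last by move=> x y _ _; exact: code_inj.
apply: eq_esum => y _; rewrite -FE -integral_cst//.
by apply: eq_integral => om; rewrite inE; exact: cst_on.
Qed.

Lemma jump_process_law x0 (Y : R -> Omega -> E) t y :
  markov_jump_process jump_intensity x0 Pr Y -> (0 <= t)%R ->
  Pr [set om | Y t om = y] = (jump_chain t x0 y)%:E.
Proof.
move=> [mY Y0 [P [Ptr Pr_rates Pm]]] t0.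
have /= := Pm [::] 0%R t x0 y (lexx _) t0 (fun r => fun (H : r \in [::]) => match notF H with end).
rewrite add0r (_ : _ `&` [set om | Y 0%R om = x0] = [set om | Y 0%R om = x0]); last first.
  by apply/seteqP; split => om //= [].
rewrite Y0 mul1e (jump_chain_unique Ptr Pr_rates)// => <-.
have m0 := mY 0%R x0 (lexx _); have mt := mY t y t0.
rewrite (measureDI _ mt m0) setIC [X in X + _](_ : _ = 0) ?add0e//.
apply/eqP; rewrite -measure_le0.
apply: (@le_trans _ _ (Pr (~` [set om | Y 0%R om = x0]))).
  apply: le_measure; [..|by move=> om []]; apply/mem_set; last exact: measurableC.
  exact: measurableD.
by rewrite probability_setC// [X in 1 - X]Y0 subee.
Qed.

Lemma jump_process_expectation x0 (Y : R -> Omega -> E) t (f : E -> R) :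
  markov_jump_process jump_intensity x0 Pr Y -> (0 <= t)%R -> locally_bounded f ->
  'E_Pr[fun om => f (Y t om)] = (T t f x0)%:E.
Proof.
move=> HY t0 fb; have [mY _ _] := HY.
have [N AN] := A_exhausts x0; have [B fB] := fb N.
have ge0_case (v : E -> R) : (forall y, 0 <= v y)%R -> locally_bounded v ->
    \int[Pr]_om (v (Y t om))%:E = (T t v x0)%:E.
  move=> v0 vb; rewrite integral_countable_valued//; last by move=> y; exact: mY.
  rewrite -jump_chain_sum//; apply: eq_esum => y _.
  by rewrite (jump_process_law _ HY t0) -EFinM mulrC.
pose fp y := Num.max (f y) 0%R; pose fn y := Num.max (- f y)%R 0%R.
have fp_le y : (`|fp y| <= `|f y|)%R.
  by rewrite /fp; case: (leP (f y)) => _; rewrite ?normr0 ?normr_ge0.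
have fn_le y : (`|fn y| <= `|f y|)%R.
  by rewrite /fn; case: (leP (- f y)%R) => _; rewrite ?normr0 ?normr_ge0// normrN.
have fpb : locally_bounded fp.
  by move=> k; have [Bk fBk] := fb k; exists Bk => y Ay; exact: le_trans (fp_le y) (fBk _ Ay).
have fnb : locally_bounded fn.
  by move=> k; have [Bk fBk] := fb k; exists Bk => y Ay; exact: le_trans (fn_le y) (fBk _ Ay).
have [Bp fpB] := fpb N; have [Bn fnB] := fnb N.
rewrite unlock /expectation integralE.
have -> : (EFin \o (fun om => f (Y t om)))^\+ = fun om => (fp (Y t om))%:E.
  by apply/funext => om; rewrite funeposE /fp EFin_max.
have -> : (EFin \o (fun om => f (Y t om)))^\- = fun om => (fn (Y t om))%:E.
  by apply/funext => om; rewrite funenegE /fn EFin_max.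
rewrite !ge0_case//; last 2 first.
- by move=> y; rewrite le_max lexx orbT.
- by move=> y; rewrite le_max lexx orbT.
rewrite -EFinB; congr EFin.
have -> : (T t fp x0 - T t fn x0 = T t (fun y => -1 * fn y + fp y) x0)%R.
  by rewrite (jump_semigroup_linear (Arates N) _ t0 fnB fpB AN); ring.
congr (T t _ x0); apply/funext => y; rewrite /fp /fn.
by case: (leP (f y)) => ?; case: leP => ?; lra.
Qed.

End expectations.

End countable_chain.

(** * Configurations, their norm and their distance *)

Section configurations.
Context {R : realType} {X : countType} (a : X -> {posnum R}).
Implicit Types (eta zeta xi : config a) (k : nat) (x y z : X).

Definition rnorm eta : R := fine (cnorm a (val eta)).
Definition rdist eta zeta : R := fine (cdist eta zeta).

Lemma rnormE eta : (rnorm eta)%:E = cnorm a (val eta).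
Proof.
rewrite /rnorm fineK// ge0_fin_numE; last by apply: esum_ge0 => x _; rewrite lee_fin mulr_ge0.
exact: set_valP eta.
Qed.

Lemma rnorm_ge0 eta : 0 <= rnorm eta.
Proof. by rewrite fine_ge0// esum_ge0// => x _; rewrite lee_fin mulr_ge0. Qed.

Lemma cdist_ge0 eta zeta : (0 <= cdist eta zeta)%E.
Proof. by apply: esum_ge0 => x _; rewrite lee_fin mulr_ge0. Qed.

Lemma rdist_ge0 eta zeta : 0 <= rdist eta zeta.
Proof. by rewrite fine_ge0// cdist_ge0. Qed.

Lemma cdist_le_norm eta zeta :
  (cdist eta zeta <= cnorm a (val eta) + cnorm a (val zeta))%E.
Proof.
rewrite /cnorm -esum_addr; [|by move=> x _; rewrite mulr_ge0..].
apply: le_esum => x _; rewrite lee_fin -mulrDl ler_wpM2r//.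
by rewrite (le_trans (ler_normB _ _))// !ger0_norm.
Qed.

Lemma rdistE eta zeta : (rdist eta zeta)%:E = cdist eta zeta.
Proof.
rewrite /rdist fineK// ge0_fin_numE ?cdist_ge0//.
by apply: le_lt_trans (cdist_le_norm _ _) _; rewrite -!rnormE -EFinD ltry.
Qed.

Lemma rdist_le_norm eta zeta : rdist eta zeta <= rnorm eta + rnorm zeta.
Proof. by rewrite -lee_fin EFinD rdistE !rnormE cdist_le_norm. Qed.

Lemma rdistC eta zeta : rdist eta zeta = rdist zeta eta.
Proof.
by congr fine; apply: eq_esum => x _; rewrite distrC.
Qed.

Lemma rdist_triangle xi eta zeta : rdist eta zeta <= rdist eta xi + rdist xi zeta.
Proof.
rewrite -lee_fin EFinD !rdistE /cdist -esum_addr; [|by move=> x _; rewrite mulr_ge0..].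
by apply: le_esum => x _; rewrite lee_fin -mulrDl ler_wpM2r// ler_distD.
Qed.

Lemma move_funE k x y eta z : (k <= val eta x)%N -> x != y ->
  (val (move k x y eta) z + k * (z == x) = val eta z + k * (z == y))%N.
Proof.
move=> kx xy; rewrite /= /move_fun kx xy /=.
have [->|zx] := eqVneq z x; first by rewrite (negPf xy) muln1 muln0 subnK// addn0.
by have [_|_] := eqVneq z y; rewrite ?muln1 ?muln0 ?addn0.
Qed.

Lemma moveN k x y eta : ~~ ((k <= val eta x)%N && (x != y)) -> move k x y eta = eta.
Proof. by move=> H; apply: val_inj; rewrite /= /move_fun (negPf H). Qed.

Lemma rdist_move k x y eta :
  rdist (move k x y eta) eta <= k%:R * ((a x)%:num + (a y)%:num).
Proof.
have [/andP[kx xy]|H] := boolP ((k <= val eta x)%N && (x != y)); last first.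
  rewrite moveN// /rdist /cdist esum1 ?mulr_ge0 ?addr_ge0// => z _.
  by rewrite subrr normr0 mul0r.
rewrite -lee_fin rdistE mulrDr EFinD.
have dE (w : X) : (\esum_(z in setT) ((w == z)%:R * (k%:R * (a z)%:num))%:E =
    (k%:R * (a w)%:num)%:E :> \bar R)%E by rewrite esum_point// => z; rewrite mulr_ge0.
rewrite -!dE /cdist -esum_addr; [|by move=> z _; rewrite !mulr_ge0..].
apply: le_esum => z _; rewrite lee_fin !mulrA -mulrDl ler_wpM2r//.
have /(congr1 (fun n => n%:R : R)) := move_funE z kx xy.
rewrite !natrD !natrM => E.
have -> : (val (move k x y eta) z)%:R - (val eta z)%:R =
   k%:R * (z == y)%:R - k%:R * (z == x)%:R :> R by rewrite -(addrK (k%:R * (z == x)%:R) (_%:R)) E; ring.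
rewrite (eq_sym x) (eq_sym y) (le_trans (ler_normB _ _))// !ger0_norm ?mulr_ge0//.
by rewrite addrC ![_ * k%:R]mulrC.
Qed.

Lemma rdist_move2 k x y eta zeta : (k <= val eta x)%N -> (k <= val zeta x)%N ->
  rdist (move k x y eta) (move k x y zeta) = rdist eta zeta.
Proof.
move=> kx kx'; have [->|xy] := eqVneq x y.
  by rewrite !moveN// eqxx andbF.
congr fine; apply: eq_esum => z _; congr (`|_| * _)%:E.
have /(congr1 (fun n => n%:R : R)) := move_funE z kx xy.
have /(congr1 (fun n => n%:R : R)) := move_funE z kx' xy.
rewrite !natrD !natrM => E E'.
rewrite -(addrK (k%:R * (z == x)%:R) (_%:R)) E' -[X in _ - X](addrK (k%:R * (z == x)%:R)) E.
by ring.
Qed.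

Definition mass_le (N : nat) : set (config a) :=
  [set eta | (\esum_(x in setT) (val eta x)%:R%:E <= N%:R%:E :> \bar R)%E].

Let fin_num_add_inj (r : R) (u v : \bar R) : (u + r%:E = v + r%:E -> u = v)%E.
Proof. by move=> /(congr1 (fun w => w - r%:E)%E); rewrite !addeK. Qed.

Lemma esum_move k x y eta :
  (\esum_(z in setT) (val (move k x y eta) z)%:R%:E =
   \esum_(z in setT) (val eta z)%:R%:E :> \bar R)%E.
Proof.
have [/andP[kx xy]|H] := boolP ((k <= val eta x)%N && (x != y)); last by rewrite moveN.
have dE (w : X) : (\esum_(z in setT) ((w == z)%:R * k%:R)%:E = k%:R%:E :> \bar R)%E.
  exact: (esum_point (F := fun=> k%:R)).
apply: (@fin_num_add_inj k%:R).
rewrite -{1}(dE x) -(dE y) -!esum_addr//; try by move=> *; rewrite mulr_ge0.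
apply: eq_esum => z _.
by rewrite (eq_sym x) (eq_sym y) ![_%:R * k%:R]mulrC -!natrM -!natrD (move_funE z kx xy).
Qed.

Lemma mass_le_move N k x y eta : mass_le N eta -> mass_le N (move k x y eta).
Proof. by rewrite /mass_le /= esum_move. Qed.

Lemma mass_le_mono N N' eta : (N <= N')%N -> mass_le N eta -> mass_le N' eta.
Proof. by move=> NN' /le_trans; apply; rewrite lee_fin ler_nat. Qed.

Lemma finite_config_mass (eta : finite_config a) : exists N, mass_le N (val eta).
Proof.
have /= := set_valP eta.
have : (0 <= \esum_(x in setT) (val (val eta) x)%:R%:E :> \bar R)%E by exact: esum_ge0.
rewrite /mass_le /=; case: (\esum_(x in setT) _)%E => [r| |]//= r0 _.
exists (Num.bound r); rewrite lee_fin; apply/ltW/archi_boundP.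
by rewrite -lee_fin.
Qed.

Lemma mass_le_finite N eta : mass_le N eta ->
  eta \in [set eta : config a | (\esum_(x in setT) (val eta x)%:R%:E < +oo :> \bar R)%E].
Proof. by move=> etaN; apply/mem_set => /=; exact: le_lt_trans etaN (ltry _). Qed.

Definition lip_on (A : set (config a)) (L : R) (u : config a -> R) :=
  forall eta zeta, A eta -> A zeta -> `|u eta - u zeta| <= L * rdist eta zeta.

Lemma lipschitz_constantE f L : lipschitz_constant f L <-> 0 < L /\ lip_on setT L f.
Proof.
rewrite /lipschitz_constant /lip_on; split=> -[L0 fL]; split=> // eta zeta.
  by move=> _ _; rewrite -lee_fin EFinM rdistE.
by rewrite -rdistE -EFinM lee_fin fL.
Qed.

End configurations.
(** * Rates of the mass migration generator *)

Section rates.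
Context {R : realType} {X : countType} (a : X -> {posnum R}).
Variables (p : X -> X -> R) (g : nat -> nat -> nat -> R) (M mp C : R).
Implicit Types (eta zeta xi : config a) (k : nat) (x y z : X) (u f : config a -> R).

Definition transitions : set (X * X * nat) := [set i | (0 < i.2)%N].
Definition rate eta (i : X * X * nat) : R := move_rate p g eta i.2 i.1.1 i.1.2.
Definition moved eta (i : X * X * nat) : config a := move i.2 i.1.1 i.1.2 eta.

Lemma generatorE f eta : generator p g f eta = jump_gen transitions rate moved f eta.
Proof. by []. Qed.

(** How far a transition [(x, y, k)] displaces a configuration. *)
Definition shift_cost (i : X * X * nat) : R :=
  i.2%:R * ((a i.1.1)%:num + (a i.1.2)%:num).

Lemma shift_cost_ge0 i : 0 <= shift_cost i.
Proof. by rewrite mulr_ge0// addr_ge0. Qed.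

Hypothesis p_trans : transition_probability p.
Hypothesis mp_ge0 : 0 <= mp.
Hypothesis p_col : forall y, (\esum_(x in setT) (p x y)%:E <= mp%:E)%E.
Hypothesis g_ge0 : forall k alpha beta, 0 <= g k alpha beta.
Hypothesis g_vanish : forall k alpha beta,
  (alpha < k)%N \/ alpha = 0%N -> g k alpha beta = 0.
Hypothesis M_gt0 : 0 < M.
Hypothesis a_bound : forall x : X,
  (\esum_(y in setT) (p x y * (a y)%:num)%:E
   + \esum_(y in setT) ((a y)%:num * p y x)%:E <= (M * (a x)%:num)%:E)%E.
Hypothesis a_summable : (\esum_(x in setT) ((a x)%:num)%:E < +oo)%E.
Hypothesis C_gt0 : 0 < C.
Hypothesis g_lip : forall alpha beta gamma delta : nat,
  \sum_(1 <= k < (maxn alpha gamma).+1)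
     k%:R * `|g k alpha beta - g k gamma delta|
  <= C * (`|alpha%:R - gamma%:R| + `|beta%:R - delta%:R|).

Let p_ge0 x y : 0 <= p x y. Proof. exact: p_trans.1. Qed.
Let p_row x : (\esum_(y in setT) (p x y)%:E = 1%E)%E. Proof. exact: p_trans.2. Qed.

Lemma rate_ge0 eta i : 0 <= rate eta i.
Proof. by rewrite mulr_ge0. Qed.

Lemma g_lip_esum (al be ga de : nat) :
  (\esum_(k in [set k | (0 < k)%N]) (k%:R * `|g k al be - g k ga de|)%:E <=
   (C * (`|al%:R - ga%:R| + `|be%:R - de%:R|))%:E)%E.
Proof.
set r := index_iota 1 (maxn al ga).+1.
rewrite (_ : esum _ _ = \esum_(k in [set` r]) (k%:R * `|g k al be - g k ga de|)%:E)%E.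
  rewrite (esum_fset (finite_seq r)); last first.
    by move=> i _; rewrite lee_fin mulr_ge0.
  rewrite -fsbig_seq ?iota_uniq// sumEFin lee_fin; exact: g_lip.
rewrite esum_mkcond [RHS]esum_mkcond; apply: eq_esum => k _.
have [kr|kr] := boolP (k \in r).
  by rewrite !mem_set//=; move: kr; rewrite mem_index_iota => /andP[].
rewrite [in RHS]memNset; last exact/negP.
case: ifPn => // /set_mem /= k0; move: kr; rewrite mem_index_iota k0 /= -leqNgt gtn_max.
by move=> /andP[h1 h2]; rewrite !g_vanish ?subrr ?normr0 ?mulr0//; left.
Qed.

Lemma g_linear (al be : nat) :
  (\esum_(k in [set k | (0 < k)%N]) (k%:R * g k al be)%:E <= (C * al%:R)%:E)%E.
Proof.
have := g_lip_esum al be 0 be; rewrite subr0 subrr normr0 addr0 ger0_norm//.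
apply: le_trans; apply: le_esum => k _.
by rewrite lee_fin [g k 0%N _]g_vanish ?subr0 ?ger0_norm//; right.
Qed.

Lemma esum_transitions (F : X -> X -> nat -> R) : (forall x y k, 0 <= F x y k) ->
  (\esum_(i in transitions) (F i.1.1 i.1.2 i.2)%:E =
   \esum_(x in setT) \esum_(y in setT) \esum_(k in [set k | (0 < k)%N]) (F x y k)%:E)%E.
Proof.
move=> F0.
rewrite (esum_esum (J := fun=> setT)
  (a := fun x y => \esum_(k in [set k | (0 < k)%N]) (F x y k)%:E)%E); last first.
  by move=> x y _ _; apply: esum_ge0 => k _; rewrite lee_fin.
rewrite (esum_esum (J := fun=> [set k | (0 < k)%N])
  (a := fun (z : X * X) k => (F z.1 z.2 k)%:E)); last first.
  by move=> z k _ _; rewrite lee_fin.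
by congr esum; apply/seteqP; split => [[[x y] k] /=|[[x y] k] [_ /=]].
Qed.

(** Sums over transitions reduce to sums over pairs of sites once the number of moved
    particles has been summed out. *)
Lemma esum_transitions_le (F : X -> X -> nat -> R) (G : X -> X -> nat -> R)
    (w H : X -> X -> R) :
  (forall x y, 0 <= w x y) -> (forall x y k, 0 <= G x y k) ->
  (forall x y k, (0 < k)%N -> 0 <= F x y k <= p x y * w x y * (k%:R * G x y k)) ->
  (forall x y, (\esum_(k in [set k | (0 < k)%N]) (k%:R * G x y k)%:E <= (H x y)%:E)%E) ->
  (\esum_(i in transitions) (F i.1.1 i.1.2 i.2)%:E <=
   \esum_(x in setT) \esum_(y in setT) (p x y * w x y * H x y)%:E)%E.
Proof.
move=> w0 G0 FG GH.
apply: (@le_trans _ _ (\esum_(i in transitions)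
   (p i.1.1 i.1.2 * w i.1.1 i.1.2 * (i.2%:R * G i.1.1 i.1.2 i.2))%:E)%E).
  by apply: le_esum => i i0; rewrite lee_fin; have /andP[] := FG i.1.1 i.1.2 _ i0.
rewrite (esum_transitions (F := fun x y k => p x y * w x y * (k%:R * G x y k))); last first.
  by move=> *; rewrite !mulr_ge0.
apply: le_esum => x _; apply: le_esum => y _.
rewrite esumZl ?mulr_ge0//; last by move=> *; rewrite mulr_ge0.
by rewrite (EFinM _ (H x y)) lee_wpmul2l// lee_fin mulr_ge0.
Qed.

Lemma rate_sum_le N eta : mass_le N eta ->
  (\esum_(i in transitions) (rate eta i)%:E <= (C * N%:R)%:E)%E.
Proof.
move=> etaN.
apply: le_trans (@esum_transitions_le (fun x y k => p x y * g k (val eta x) (val eta y))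
  (fun x y k => g k (val eta x) (val eta y)) (fun _ _ => 1)
  (fun x _ => C * (val eta x)%:R) _ _ _ _) _ => //.
- move=> x y k k0; rewrite mulr1 mulr_ge0//= ler_wpM2l// ler_peMl// ler1n//.
- by move=> x y; exact: g_linear.
rewrite (EFinM C); apply: (@le_trans _ _ (C%:E * \esum_(x in setT) (val eta x)%:R%:E)%E); last first.
  by rewrite lee_wpmul2l// lee_fin ltW.
rewrite -esumZl ?(ltW C_gt0)//; apply: le_esum => x _.
rewrite (eq_esum (b := fun y => ((C * (val eta x)%:R) * p x y)%:E)); last first.
  by move=> y _; rewrite mulr1 mulrC.
by rewrite esumZl ?mulr_ge0 ?(ltW C_gt0)// p_row mule1.
Qed.

(** This and [esum_pair_le] are where the conditions on [a] and [p] enter: the weight of the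
    source of a jump is summed with the rows of [p], that of its target with [a_bound]. *)
Lemma esum_source_le (de : X -> R) (S : R) : (forall x, 0 <= de x) ->
  (\esum_(x in setT) (de x * (a x)%:num)%:E <= S%:E)%E ->
  (\esum_(x in setT) \esum_(y in setT) (p x y * ((a x)%:num + (a y)%:num) * (C * de x))%:E
   <= (C * (1 + M) * S)%:E)%E.
Proof.
move=> de0 S_ge.
apply: (@le_trans _ _ (\esum_(x in setT) ((C * (1 + M)) * (de x * (a x)%:num))%:E)%E).
  apply: le_esum => x _.
  rewrite (eq_esum (b := fun y => (C * de x * ((a x)%:num * p x y + p x y * (a y)%:num))%:E)); last first.
    by move=> y _; congr EFin; ring.
  have cd : 0 <= C * de x by rewrite mulr_ge0// ltW.
  rewrite esumZl//; last by move=> y _; rewrite addr_ge0// mulr_ge0.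
  rewrite esum_addr; [|by move=> y _; rewrite mulr_ge0..].
  rewrite [leRHS](_ : _ = ((C * de x)%:E * ((a x)%:num + M * (a x)%:num)%:E)%E); last first.
    by rewrite -EFinM; congr EFin; ring.
  rewrite lee_wpmul2l ?lee_fin// EFinD leeD//.
    by rewrite esumZl// p_row mule1.
  apply: le_trans (a_bound x); rewrite leeDl// esum_ge0// => y _.
  by rewrite lee_fin mulr_ge0.
rewrite esumZl; last 2 first.
- by rewrite mulr_ge0 ?ltW// addr_gt0.
- by move=> x _; rewrite mulr_ge0.
by rewrite (EFinM _ S) lee_wpmul2l// lee_fin mulr_ge0 ?ltW// addr_gt0.
Qed.

Definition lip_growth := C * (1 + M + mp).

(** Exchanging the two sums where the increment sits at the target turns the rows of [p]
    into columns, which brings in the second half of [a_bound] and the column sums [mp]. *)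
Lemma esum_pair_le (de : X -> R) (S : R) : (forall x, 0 <= de x) ->
  (\esum_(x in setT) (de x * (a x)%:num)%:E <= S%:E)%E ->
  (\esum_(x in setT) \esum_(y in setT)
      (p x y * ((a x)%:num + (a y)%:num) * (C * (de x + de y)))%:E
   <= (lip_growth * S)%:E)%E.
Proof.
move=> de0 S_ge; have C0 := ltW C_gt0.
pose out x := (\esum_(y in setT) (p x y * (a y)%:num)%:E)%E.
pose inc x := (\esum_(y in setT) ((a y)%:num * p y x)%:E)%E.
have out0 x : (0 <= out x)%E by apply: esum_ge0 => y _; rewrite lee_fin mulr_ge0.
have inc0 x : (0 <= inc x)%E by apply: esum_ge0 => y _; rewrite lee_fin mulr_ge0.
pose s1 x y := (C * de x * (a x)%:num) * p x y + (C * de x) * (p x y * (a y)%:num).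
pose s2 x y := (C * de y) * ((a x)%:num * p x y) + (C * de y * (a y)%:num) * p x y.
have s1_ge0 x y : 0 <= s1 x y by rewrite addr_ge0// !mulr_ge0.
have s2_ge0 x y : 0 <= s2 x y by rewrite addr_ge0// !mulr_ge0.
rewrite (_ : esum _ _ = (\esum_(x in setT) \esum_(y in setT) (s1 x y)%:E +
                         \esum_(x in setT) \esum_(y in setT) (s2 y x)%:E)%E); last first.
  rewrite (esum_exchange (f := fun x y => (s2 y x)%:E)) -?esumD.
  - apply: eq_esum => x _; rewrite -esum_addr//; apply: eq_esum => y _.
    by congr EFin; rewrite /s1 /s2; ring.
  - by move=> x _; apply: esum_ge0 => y _; rewrite lee_fin.
  - by move=> x _; apply: esum_ge0 => y _; rewrite lee_fin.
  - by move=> x y _ _; rewrite lee_fin.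
rewrite -esumD; last 2 first.
- by move=> x _; apply: esum_ge0 => y _; rewrite lee_fin.
- by move=> x _; apply: esum_ge0 => y _; rewrite lee_fin.
apply: (@le_trans _ _ (\esum_(x in setT) (lip_growth * (de x * (a x)%:num))%:E)%E); last first.
  rewrite esumZl; last 2 first.
  - by rewrite mulr_ge0// !addr_ge0// ltW.
  - by move=> x _; rewrite mulr_ge0.
  by rewrite (EFinM _ S) lee_wpmul2l// lee_fin mulr_ge0// !addr_ge0// ltW.
apply: le_esum => x _.
have cd : 0 <= C * de x by rewrite mulr_ge0.
have cda : 0 <= C * de x * (a x)%:num by rewrite mulr_ge0.
rewrite /s1 /s2 !esum_addr; try by move=> *; rewrite !mulr_ge0.
rewrite !esumZl//; try by move=> *; rewrite mulr_ge0.
rewrite p_row mule1 -/(out x) -/(inc x).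
have := a_bound x; rewrite -/(out x) -/(inc x).
have := p_col x; have := esum_ge0 (fun y (_ : setT y) => p_ge0 y x : (0 <= (p y x)%:E)%E).
have := out0 x; have := inc0 x; move: (out x) (inc x) (esum _ _).
move=> [u1| |] [i| |] [q| |] //.
rewrite -!EFinM -!EFinD !lee_fin => i0 u0 q0 qm ui.
rewrite /lip_growth.
have h1 : C * de x * (u1 + i) <= C * de x * (M * (a x)%:num) by rewrite ler_wpM2l.
have h2 : C * de x * (a x)%:num * q <= C * de x * (a x)%:num * mp by rewrite ler_wpM2l.
rewrite -subr_ge0; move: h1 h2; rewrite -subr_ge0 -[X in _ -> is_true X -> _]subr_ge0 => h1 h2.
rewrite [leRHS](_ : _ = (C * de x * (M * (a x)%:num) - C * de x * (u1 + i)) +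
  (C * de x * (a x)%:num * mp - C * de x * (a x)%:num * q)); last by ring.
by rewrite addr_ge0.
Qed.

(** * The basic coupling *)

Local Notation Q := (jump_gen transitions rate moved).
Local Notation T := (jump_semigroup transitions rate moved).
Local Notation euler := (euler_step transitions rate moved).

Lemma rate_shift_le eta :
  (\esum_(i in transitions) (rate eta i * shift_cost i)%:E <=
   (C * (1 + M) * rnorm eta)%:E)%E.
Proof.
apply: le_trans (@esum_transitions_le
  (fun x y k => p x y * g k (val eta x) (val eta y) * (k%:R * ((a x)%:num + (a y)%:num)))
  (fun x y k => g k (val eta x) (val eta y)) (fun x y => (a x)%:num + (a y)%:num)
  (fun x _ => C * (val eta x)%:R) _ _ _ _) _ => //.
- move=> x y k _; apply/andP; split; first by rewrite !mulr_ge0// addr_ge0.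
  by rewrite le_eqVlt; apply/orP; left; apply/eqP; ring.
- by move=> x y; exact: g_linear.
by apply: esum_source_le => //; rewrite rnormE.
Qed.

Lemma rate_diff_shift_le eta zeta :
  (\esum_(i in transitions) (`|rate eta i - rate zeta i| * shift_cost i)%:E <=
   (lip_growth * rdist eta zeta)%:E)%E.
Proof.
apply: le_trans (@esum_transitions_le
  (fun x y k => `|p x y * g k (val eta x) (val eta y) - p x y * g k (val zeta x) (val zeta y)|
     * (k%:R * ((a x)%:num + (a y)%:num)))
  (fun x y k => `|g k (val eta x) (val eta y) - g k (val zeta x) (val zeta y)|)
  (fun x y => (a x)%:num + (a y)%:num)
  (fun x y => C * (`|(val eta x)%:R - (val zeta x)%:R| + `|(val eta y)%:R - (val zeta y)%:R|))
  _ _ _ _) _ => //.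
- move=> x y k _; apply/andP; split; first by rewrite !mulr_ge0// addr_ge0.
  rewrite -mulrBr normrM (ger0_norm (p_ge0 _ _)).
  by rewrite le_eqVlt; apply/orP; left; apply/eqP; ring.
- by move=> x y; exact: g_lip_esum.
by apply: (esum_pair_le (de := fun x => `|(val eta x)%:R - (val zeta x)%:R|)) => //; rewrite rdistE.
Qed.

Lemma lip_moved A L u eta i : 0 <= L -> lip_on A L u -> A eta -> A (moved eta i) ->
  `|u (moved eta i) - u eta| <= L * shift_cost i.
Proof.
move=> L0 uL Ae Am; apply: le_trans (uL _ _ Am Ae) _.
by rewrite ler_wpM2l// rdist_move.
Qed.

(** A transition changes [u] by at most [L] times its cost, and [rate_shift_le] sums up the
    costs. *)
Lemma jump_gen_lip_le A L u eta : (forall xi i, A xi -> A (moved xi i)) ->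
  0 <= L -> lip_on A L u -> A eta -> `|Q u eta| <= L * (C * (1 + M) * rnorm eta).
Proof.
move=> Acl L0 uL Ae.
apply: (rsum_norm_le (g := fun i => L * (rate eta i * shift_cost i))).
  move=> i _; rewrite normrM ger0_norm ?rate_ge0// mulrCA.
  by rewrite ler_wpM2l ?rate_ge0//; apply: (lip_moved L0 uL Ae); exact: Acl.
rewrite esumZl//; last by move=> i _; rewrite mulr_ge0 ?rate_ge0 ?shift_cost_ge0.
by rewrite (EFinM L) lee_wpmul2l ?lee_fin// rate_shift_le.
Qed.

(** The basic coupling, one transition at a time: the smaller of the two rates moves both
    configurations, the excess moves only one of them. *)
Lemma coupling_ineq (r s d e u0 v0 u1 v1 : R) : 0 <= r -> 0 <= s -> 0 <= e ->
  u0 - v0 <= d -> u1 - v0 <= d + e -> u0 - v1 <= d + e ->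
  (0 < r -> 0 < s -> u1 - v1 <= d) ->
  r * (u1 - u0) - s * (v1 - v0) <= (r + s) * (d - (u0 - v0)) + `|r - s| * e.
Proof.
move=> r0 s0 e0 h00 h10 h01 h11.
have [s00|sn] := eqVneq s 0.
  by rewrite s00 subr0 ger0_norm//; nra.
have [r00|rn] := eqVneq r 0.
  by rewrite r00 sub0r normrN ger0_norm//; nra.
have {}h11 : u1 - v1 <= d by apply: h11; rewrite lt_neqAle eq_sym ?rn ?sn.
have [sr|rs] := leP s r; [rewrite ger0_norm ?subr_ge0//|rewrite ltr0_norm ?subr_lt0//].
  have -> : r * (u1 - u0) - s * (v1 - v0) =
    s * (u1 - v1) + (r - s) * (u1 - v0) - r * (u0 - v0) by ring.
  nra.
have -> : r * (u1 - u0) - s * (v1 - v0) =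
  r * (u1 - v1) + (s - r) * (u0 - v1) - s * (u0 - v0) by ring.
nra.
Qed.

Lemma rate_gt0 eta i : 0 < rate eta i -> (i.2 <= val eta i.1.1)%N.
Proof.
rewrite leqNgt; apply: contraL => h.
by rewrite /rate /move_rate g_vanish ?mulr0 ?ltxx//; left.
Qed.

Lemma mass_le_moved N eta i : mass_le N eta -> mass_le N (moved eta i).
Proof. exact: mass_le_move. Qed.

Lemma lip_growth_ge0 : 0 <= lip_growth.
Proof. by rewrite mulr_ge0 ?(ltW C_gt0)// !addr_ge0// ltW. Qed.

(** Sum [coupling_ineq] over the transitions. The smallness condition on [h] bounds the
    rates of both configurations together, hence the factor 2: then [h] times the
    coefficient of [d - (u eta - u zeta)] in the sum is at most one. *)
Lemma euler_lip N h u L B : 0 <= h -> h * (2 * (C * N%:R)) <= 1 -> 0 <= L ->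
  bounded_on (mass_le N) u B -> lip_on (mass_le N) L u ->
  lip_on (mass_le N) (L * (1 + h * lip_growth)) (euler h u).
Proof.
move=> h0 hN L0 uB uL.
suff half eta zeta : mass_le N eta -> mass_le N zeta ->
    euler h u eta - euler h u zeta <= L * (1 + h * lip_growth) * rdist eta zeta.
  move=> eta zeta He Hz; rewrite ler_norml lerNl opprB half// andbT.
  by rewrite rdistC half.
move=> He Hz; set d := L * rdist eta zeta; pose De := u eta - u zeta.
have Dd : De <= d by apply: le_trans (ler_norm _) (uL _ _ He Hz).
have rsum_le xi : mass_le N xi -> rsum transitions (rate xi) <= C * N%:R.
  move=> Hxi; rewrite -lee_fin rsum_ge0E ?rate_sum_le//; first by move=> i _; exact: rate_ge0.
  apply: (summ_le (g := rate xi)); first by move=> i _; rewrite ger0_norm// rate_ge0.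
  exact: le_lt_trans (rate_sum_le Hxi) (ltry _).
have summ_rate xi : mass_le N xi -> summable transitions (EFin \o rate xi).
  move=> Hxi; apply: (summ_le (g := rate xi)); first by move=> i _; rewrite ger0_norm// rate_ge0.
  exact: le_lt_trans (rate_sum_le Hxi) (ltry _).
pose G i := (d - De) * (rate eta i + rate zeta i) +
            L * (`|rate eta i - rate zeta i| * shift_cost i).
have summ_cost : summable transitions (EFin \o
    (fun i => `|rate eta i - rate zeta i| * shift_cost i)).
  apply: (summ_le (g := fun i => `|rate eta i - rate zeta i| * shift_cost i)).
    by move=> i _; rewrite ger0_norm// mulr_ge0// shift_cost_ge0.
  exact: le_lt_trans (rate_diff_shift_le _ _) (ltry _).
have rcost : rsum transitions (fun i => `|rate eta i - rate zeta i| * shift_cost i) <=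
    lip_growth * rdist eta zeta.
  rewrite -lee_fin rsum_ge0E ?rate_diff_shift_le// => i _.
  by rewrite mulr_ge0// shift_cost_ge0.
have summ_jump xi : mass_le N xi ->
    summable transitions (EFin \o (fun i => rate xi i * (u (moved xi i) - u xi))).
  move=> Hxi; apply: (summ_le (g := fun i => L * (rate xi i * shift_cost i))).
    move=> i _; rewrite normrM ger0_norm ?rate_ge0// mulrCA ler_wpM2l ?rate_ge0//.
    by apply: (lip_moved L0 uL Hxi); exact: mass_le_moved.
  rewrite esumZl//; last by move=> i _; rewrite mulr_ge0 ?rate_ge0 ?shift_cost_ge0.
  by rewrite lte_mul_pinfty ?lee_fin//; exact: le_lt_trans (rate_shift_le _) (ltry _).
have QG : Q u eta - Q u zeta <= (d - De) * (2 * (C * N%:R)) + L * (lip_growth * rdist eta zeta).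
  rewrite /Q -rsumB; [|exact: summ_jump..].
  apply: (@le_trans _ _ (rsum transitions G)).
    apply: ler_rsum.
    - by apply: summB; exact: summ_jump.
    - by apply: summD; apply: summZ => //; apply: summD; exact: summ_rate.
    move=> i i0; rewrite /G [L * _]mulrCA [(d - De) * _]mulrC.
    have ui xi : mass_le N xi -> mass_le N (moved xi i) by exact: mass_le_moved.
    apply: coupling_ineq; rewrite ?rate_ge0// ?mulr_ge0 ?shift_cost_ge0//.
    - have -> : u (moved eta i) - u zeta = De + (u (moved eta i) - u eta) by rewrite /De; ring.
      by rewrite lerD//; apply: le_trans (ler_norm _) (lip_moved L0 uL He (ui _ He)).
    - have -> : u eta - u (moved zeta i) = De - (u (moved zeta i) - u zeta) by rewrite /De; ring.
      rewrite lerD//; apply: le_trans (lip_moved L0 uL Hz (ui _ Hz)).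
      by rewrite -normrN ler_norm.
    - move=> /rate_gt0 k1 /rate_gt0 k2; apply: le_trans (ler_norm _) _.
      by apply: le_trans (uL _ _ (ui _ He) (ui _ Hz)) _; rewrite rdist_move2.
  rewrite /G rsumD; [|by apply: summZ; apply: summD; exact: summ_rate|exact: summZ].
  rewrite !rsumZ//; last by apply: summD; exact: summ_rate.
  rewrite lerD//; last by rewrite ler_wpM2l.
  rewrite ler_wpM2l ?subr_ge0// rsumD; [|exact: summ_rate..].
  by rewrite mulr_natl mulr2n lerD// rsum_le.
rewrite {1 2}/euler_step opprD addrACA -mulrBr -/De.
have := ler_wpM2l h0 QG; rewrite mulrDr => hQG.
apply: (le_trans (lerD (lexx _) hQG)).
have : h * ((d - De) * (2 * (C * N%:R))) <= d - De.
  by rewrite mulrCA ler_piMr// subr_ge0.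
rewrite [L * _ * _](_ : _ = d + h * (L * (lip_growth * rdist eta zeta))); last first.
  by rewrite /d; ring.
lra.
Qed.

Lemma mass_le_rates N : bounded_rates transitions rate moved (mass_le N) (C * N%:R).
Proof.
split; [exact: rate_ge0|by rewrite mulr_ge0// ltW| |exact: rate_sum_le].
by move=> eta i etaN _; exact: mass_le_moved.
Qed.

Lemma iter_euler_lip N h u L B n : 0 <= h -> h * (2 * (C * N%:R)) <= 1 -> 0 <= L ->
  bounded_on (mass_le N) u B -> lip_on (mass_le N) L u ->
  lip_on (mass_le N) (L * expR (n%:R * h * lip_growth)) (iter n (euler h) u).
Proof.
move=> h0 hN L0 uB uL.
have hlam : h * (C * N%:R) <= 1.
  apply: le_trans hN; rewrite ler_wpM2l// ler_peMl ?mulr_ge0 ?(ltW C_gt0)//.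
  by rewrite ler1n.
elim: n => [|n IHn]; first by rewrite !mul0r expR0 mulr1.
have itB := bounded_on_iter_euler (mass_le_rates N) n h0 hlam uB.
move=> eta zeta He Hz; rewrite iterS.
have LE : 0 <= L * expR (n%:R * h * lip_growth) by rewrite mulr_ge0// expR_ge0.
apply: le_trans (euler_lip h0 hN LE itB IHn He Hz) _.
rewrite ler_wpM2r ?rdist_ge0// -mulrA ler_wpM2l// -natr1 !mulrDl expRD mul1r.
by rewrite ler_wpM2l ?expR_ge0// expR_ge1Dx.
Qed.

Lemma jump_semigroup_lip N t u L B : 0 <= t -> 0 <= L ->
  bounded_on (mass_le N) u B -> lip_on (mass_le N) L u ->
  lip_on (mass_le N) (L * expR (lip_growth * t)) (T t u).
Proof.
move=> t0 L0 uB uL eta zeta He Hz.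
apply: (@cvgr_to_le _ (\oo : set_system nat) _ R
  (fun n => `|euler_approx transitions rate moved t u n.+1 eta -
              euler_approx transitions rate moved t u n.+1 zeta|)).
  apply: cvg_norm; apply: cvgB.
    exact: (cvg_euler_approx (mass_le_rates N) t0 uB He).
  exact: (cvg_euler_approx (mass_le_rates N) t0 uB Hz).
near=> n.
have tn : t / n.+1%:R * (2 * (C * N%:R)) <= 1.
  by rewrite mulrAC ler_pdivrMr// mul1r; near: n; exact: near_ge_natr.
have := iter_euler_lip n.+1 (divr_ge0 t0 (ler0n R n.+1)) tn L0 uB uL He Hz.
by rewrite [n.+1%:R * _]mulrC divfK// [t * _]mulrC.
Unshelve. all: by end_near. Qed.

(** Linear in the norm of the configuration, whatever its mass: this is what survives the
    passage to infinite configurations. *)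
Lemma jump_semigroup_time_le N t u L B eta : 0 <= t -> 0 <= L ->
  bounded_on (mass_le N) u B -> lip_on (mass_le N) L u -> mass_le N eta ->
  `|T t u eta - u eta| <= t * (L * expR (lip_growth * t) * (C * (1 + M) * rnorm eta)).
Proof.
move=> t0 L0 uB uL He.
set b := (X in t * X).
apply: (@cvgr_to_le _ (\oo : set_system nat) _ R
  (fun n => `|euler_approx transitions rate moved t u n.+1 eta - u eta|)).
  apply: cvg_norm; apply: cvgB; last exact: cvg_cst.
  exact: (cvg_euler_approx (mass_le_rates N) t0 uB He).
near=> n.
have tn : t / n.+1%:R * (2 * (C * N%:R)) <= 1.
  by rewrite mulrAC ler_pdivrMr// mul1r; near: n; exact: near_ge_natr.
rewrite /euler_approx; set h := t / n.+1%:R.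
have h0 : 0 <= h by exact: divr_ge0.
have nh : n.+1%:R * h = t by rewrite mulrC divfK.
suff H j : (j <= n.+1)%N -> `|iter j (euler h) u eta - u eta| <= j%:R * h * b.
  by rewrite -[X in X * b]nh H.
elim: j => [|j IHj] jn; first by rewrite subrr normr0 !mul0r.
rewrite iterS {1}/euler_step addrAC; apply: le_trans (ler_normD _ _) _.
rewrite -natr1 !mulrDl mul1r lerD ?IHj 1?ltnW// normrM (ger0_norm h0) ler_wpM2l//.
have LE : 0 <= L * expR (j%:R * h * lip_growth) by rewrite mulr_ge0// expR_ge0.
have itL := iter_euler_lip j h0 tn L0 uB uL.
apply: le_trans (jump_gen_lip_le (fun xi i => @mass_le_moved N xi i) LE itL He) _.
rewrite /b ler_wpM2r// ?mulr_ge0 ?rnorm_ge0 ?addr_ge0 ?(ltW C_gt0) ?(ltW M_gt0)//.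
rewrite ler_wpM2l// ler_expR mulrC ler_wpM2l ?lip_growth_ge0// -nh.
by rewrite ler_wpM2r// ler_nat ltnW.
Unshelve. all: by end_near. Qed.

Lemma rnorm_mass_le N eta : mass_le N eta ->
  rnorm eta <= fine (\esum_(x in setT) ((a x)%:num)%:E)%E * N%:R.
Proof.
move=> etaN; set al := fine _.
have alE : al%:E = (\esum_(x in setT) ((a x)%:num)%:E)%E.
  by rewrite fineK// ge0_fin_numE// esum_ge0.
have a_le x : (a x)%:num <= al.
  by rewrite -lee_fin alE; exact: (@le_esum_term _ _ setT (fun x => (a x)%:num)).
have al0 : 0 <= al by rewrite -lee_fin alE esum_ge0.
rewrite -lee_fin rnormE EFinM.
apply: (@le_trans _ _ (al%:E * \esum_(x in setT) (val eta x)%:R%:E)%E); last first.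
  by rewrite lee_wpmul2l// lee_fin.
rewrite -esumZl//; apply: le_esum => x _.
by rewrite lee_fin mulrC ler_wpM2r.
Qed.

Lemma lip_bounded_on N L u : 0 <= L -> lip_on (mass_le N) L u ->
  exists B, bounded_on (mass_le N) u B.
Proof.
move=> L0 uL.
have [[xi Hxi]|H] := pselect (exists xi, mass_le N xi : Prop); last first.
  by exists 0 => xi Hxi; exfalso; apply: H; exists xi.
exists (`|u xi| + L * (2 * (fine (\esum_(x in setT) ((a x)%:num)%:E)%E * N%:R))) => eta He.
rewrite -[u eta](subrK (u xi)) addrC; apply: le_trans (ler_normD _ _) _.
rewrite lerD//; apply: le_trans (uL _ _ He Hxi) _; rewrite ler_wpM2l//.
rewrite (le_trans (rdist_le_norm _ _))// mulr_natl mulr2n lerD//; exact: rnorm_mass_le.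
Qed.

(** * Extension from finite to infinite configurations *)

Definition cut_fun (n : nat) (eta : X -> nat) : X -> nat :=
  fun x => if (choice.pickle x < n)%N then eta x else 0%N.

Lemma cut_fun_config n eta :
  cut_fun n (val eta) \in [set eta : X -> nat | (cnorm a eta < +oo)%E].
Proof.
apply/mem_set => /=; apply: le_lt_trans (set_valP eta); apply: le_esum => x _.
by rewrite lee_fin ler_wpM2r// ler_nat /cut_fun; case: ifP.
Qed.

Definition cut (n : nat) (eta : config a) : config a :=
  exist _ (cut_fun n (val eta)) (cut_fun_config n eta).

Lemma rnorm_cut n eta : rnorm (cut n eta) <= rnorm eta.
Proof.
rewrite -lee_fin !rnormE; apply: le_esum => x _.
by rewrite lee_fin ler_wpM2r// ler_nat /= /cut_fun; case: ifP.
Qed.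

Definition finite_mass : set (config a) := [set eta | exists N, mass_le N eta].

Lemma cut_finite_mass n eta : finite_mass (cut n eta).
Proof.
have Jfin : finite_set [set x : X | (choice.pickle x < n)%N].
  apply: (@finite_preimage _ _ `I_n choice.pickle); last exact: finite_II.
  by move=> x y _ _; exact: (pcan_inj choice.pickleK).
pose s := \sum_(x \in [set x : X | (choice.pickle x < n)%N]) ((val eta x)%:R : R).
exists (Num.bound s); rewrite /mass_le /=.
rewrite (_ : esum _ _ = s%:E).
  by rewrite lee_fin; apply/ltW/archi_boundP; rewrite /s fsbig_finite//= sumr_ge0.
rewrite -fsumEFin// -esum_fset//.
rewrite [RHS]esum_mkcond; apply: eq_esum => x _; rewrite /cut_fun.
by case: ifPn => h; [rewrite mem_set|rewrite memNset//; exact/negP].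
Qed.

Lemma rdist_cut_cvg eta : rdist (cut n eta) eta @[n --> \oo] --> (0 : R).
Proof.
have rs n : rdist (cut n eta) eta =
    rsum setT (fun x => `|(val (cut n eta) x)%:R - (val eta x)%:R| * (a x)%:num).
  apply: EFin_inj; rewrite rdistE rsum_ge0E//.
  apply: (summ_le (g := fun x => `|(val (cut n eta) x)%:R - (val eta x)%:R| * (a x)%:num)).
    by move=> x _; rewrite ger0_norm// mulr_ge0.
  by rewrite -/(cdist _ _) -rdistE ltry.
under eq_fun do rewrite rs.
have -> : 0 = rsum (@setT X) (fun=> 0 - 0 : R).
  by rewrite rsum_sub ?subrr//; exact: summ0.
apply: (rsum_dominated_cvg (g := fun x => (val eta x)%:R * (a x)%:num)).
- move=> n x _; rewrite ger0_norm ?mulr_ge0// ler_wpM2r// /= /cut_fun.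
  by case: ifP => _; [rewrite subrr normr0|rewrite sub0r normrN ger0_norm].
- exact: set_valP eta.
- move=> x _; rewrite subr0; apply: cvg_near_cst; near=> n.
  rewrite /= /cut_fun ifT ?subrr ?normr0 ?mul0r//.
  by near: n; exact: nbhs_infty_gt.
Unshelve. all: by end_near. Qed.

Lemma moved_cut n eta i : (choice.pickle i.1.1 < n)%N -> (choice.pickle i.1.2 < n)%N ->
  moved (cut n eta) i = cut n (moved eta i).
Proof.
move=> xn yn; apply: val_inj; apply/funext => z /=.
rewrite /move_fun /= /cut_fun xn; case: ifPn => //= _.
have [->|zx] := eqVneq z i.1.1; first by rewrite xn.
by have [->|zy] := eqVneq z i.1.2; first by rewrite yn.
Qed.

Lemma lip_cut_cvg L f eta : lip_on setT L f -> f (cut n eta) @[n --> \oo] --> f eta.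
Proof.
move=> fL; apply/cvgrPdist_le => e e0.
have : L * rdist (cut n eta) eta @[n --> \oo] --> (0 : R).
  by rewrite -(mulr0 L); apply: cvgM; [exact: cvg_cst|exact: rdist_cut_cvg].
move=> /cvgrPdist_le/(_ _ e0); apply: filterS => n; rewrite sub0r normrN => h.
rewrite distrC; apply: le_trans (fL _ _ _ _) _ => //.
exact: le_trans (ler_norm _) h.
Qed.

Definition extend (u : config a -> R) (eta : config a) : R := limn (fun n => u (cut n eta)).

Lemma extend_cvg L u eta : lip_on finite_mass L u ->
  u (cut n eta) @[n --> \oo] --> extend u eta.
Proof.
move=> uL; apply: cauchy_cvg; apply: cauchy_exP => e e0.
have : L * rdist (cut n eta) eta @[n --> \oo] --> (0 : R).
  by rewrite -(mulr0 L); apply: cvgM; [exact: cvg_cst|exact: rdist_cut_cvg].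
have e2 : 0 < e / 2 by rewrite divr_gt0.
move=> /cvgrPdist_lt/(_ _ e2) [N _ HN].
have {}HN n : (N <= n)%N -> `|L| * rdist (cut n eta) eta < e / 2.
  by move=> /HN /=; rewrite sub0r normrN normrM (ger0_norm (rdist_ge0 _ _)).
exists (u (cut N eta)); exists N => // n /= Nn; rewrite /ball /=.
apply: le_lt_trans (uL _ _ (cut_finite_mass _ _) (cut_finite_mass _ _)) _.
apply: (@le_lt_trans _ _ (`|L| * (rdist (cut N eta) eta + rdist (cut n eta) eta))).
  apply: (@le_trans _ _ (`|L| * rdist (cut N eta) (cut n eta))).
    by rewrite ler_wpM2r ?rdist_ge0// ler_norm.
  rewrite ler_wpM2l// (le_trans (rdist_triangle eta _ _))//.
  by rewrite [rdist eta _]rdistC.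
by rewrite mulrDr [ltRHS]splitr ltrD// HN.
Qed.

Lemma extendE L u eta : lip_on finite_mass L u -> finite_mass eta -> extend u eta = u eta.
Proof.
move=> uL Fe; apply/cvg_lim => //; apply/cvgrPdist_le => e e0.
have : L * rdist (cut n eta) eta @[n --> \oo] --> (0 : R).
  by rewrite -(mulr0 L); apply: cvgM; [exact: cvg_cst|exact: rdist_cut_cvg].
move=> /cvgrPdist_le/(_ _ e0); apply: filterS => n; rewrite sub0r normrN => h.
rewrite distrC; apply: le_trans (uL _ _ (cut_finite_mass _ _) Fe) _.
exact: le_trans (ler_norm _) h.
Qed.

Lemma extend_lip L u : 0 <= L -> lip_on finite_mass L u -> lip_on setT L (extend u).
Proof.
move=> L0 uL eta zeta _ _.
apply: (@ler_cvg_to _ (\oo : set_system nat) _ R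
  (fun n => `|u (cut n eta) - u (cut n zeta)|)
  (fun n => L * (rdist (cut n eta) eta + (rdist eta zeta + rdist (cut n zeta) zeta)))).
- by apply: cvg_norm; apply: cvgB; exact: extend_cvg uL.
- apply: cvgM; first exact: cvg_cst.
  rewrite -[X in _ --> X]add0r -[X in _ --> _ + X]addr0.
  apply: cvgD; first exact: rdist_cut_cvg.
  by apply: cvgD; [exact: cvg_cst|exact: rdist_cut_cvg].
- apply: nearW => n; apply: le_trans (uL _ _ (cut_finite_mass _ _) (cut_finite_mass _ _)) _.
  rewrite ler_wpM2l// (le_trans (rdist_triangle eta _ _))// lerD2l.
  by rewrite (le_trans (rdist_triangle zeta _ _))// lerD2l rdistC.
Qed.

(** Each transition is eventually unaffected by the truncation. Before that, the truncation
    may have emptied its source, and then the rate vanishes, or its target, which is why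
    the dominating family contains the rate towards an empty site. *)
Lemma jump_gen_cut_cvg L f eta : 0 <= L -> lip_on setT L f ->
  Q f (cut n eta) @[n --> \oo] --> Q f eta.
Proof.
move=> L0 fL.
apply: (rsum_dominated_cvg (g := fun i => L *
  ((p i.1.1 i.1.2 * (g i.2 (val eta i.1.1) (val eta i.1.2) + g i.2 (val eta i.1.1) 0%N))
   * shift_cost i))).
- move=> n i _; rewrite normrM ger0_norm ?rate_ge0// mulrCA.
  apply: le_trans (ler_wpM2l (rate_ge0 _ _) (@lip_moved setT L f (cut n eta) i L0 fL I I)) _.
  rewrite ler_wpM2r ?(mulr_ge0 L0) ?shift_cost_ge0// /rate /move_rate ler_wpM2l//=.
  rewrite /cut_fun; case: ifP => _; last first.
    by rewrite [g _ 0%N _]g_vanish; [rewrite addr_ge0|right].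
  by case: ifP => _; rewrite ?lerDl ?lerDr.
- rewrite esumZl//; last first.
    by move=> i _; rewrite !mulr_ge0 ?addr_ge0.
  rewrite lte_mul_pinfty ?lee_fin//.
  apply: le_lt_trans (ltry (C * (1 + M) * (2 * rnorm eta))).
  apply: le_trans (@esum_transitions_le (fun x y k => p x y *
      (g k (val eta x) (val eta y) + g k (val eta x) 0%N) *
      (k%:R * ((a x)%:num + (a y)%:num)))
    (fun x y k => g k (val eta x) (val eta y) + g k (val eta x) 0%N)
    (fun x y => (a x)%:num + (a y)%:num)
    (fun x _ => C * (2 * (val eta x)%:R)) _ _ _ _) _ => //.
  + by move=> x y k; rewrite addr_ge0.
  + move=> x y k _; apply/andP; split; first by rewrite !mulr_ge0// addr_ge0.
    by rewrite le_eqVlt; apply/orP; left; apply/eqP; ring.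
  + move=> x y; under eq_esum do rewrite mulrDr.
    rewrite esum_addr; [|by move=> *; rewrite mulr_ge0..].
    by rewrite mulrCA mulr_natl mulr2n EFinD leeD// g_linear.
  apply: (esum_source_le (de := fun x => 2 * (val eta x)%:R)) => //.
  under eq_esum do rewrite -mulrA.
  rewrite esumZl//.
  by rewrite EFinM rnormE.
- move=> i _; apply: cvgM.
    apply: cvg_near_cst; near=> n; rewrite /rate /move_rate /= /cut_fun !ifT//.
      by near: n; exact: nbhs_infty_gt.
    by near: n; exact: nbhs_infty_gt.
  apply: cvgB; last exact: lip_cut_cvg fL.
  apply: cvg_trans (@lip_cut_cvg L f (moved eta i) fL).
  apply: near_eq_cvg; near=> n; rewrite moved_cut//.
    by near: n; exact: nbhs_infty_gt.
  by near: n; exact: nbhs_infty_gt.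
Unshelve. all: by end_near. Qed.

Lemma sub_lip_on A A' L u : A `<=` A' -> lip_on A' L u -> lip_on A L u.
Proof. by move=> AA' uL eta zeta /AA' ? /AA' ?; exact: uL. Qed.

Lemma sub_mass_finite N : mass_le N `<=` finite_mass.
Proof. by move=> eta; exists N. Qed.

Lemma jump_semigroup_lip_finite t L f : 0 <= t -> 0 <= L -> lip_on finite_mass L f ->
  lip_on finite_mass (L * expR (lip_growth * t)) (T t f).
Proof.
move=> t0 L0 fL eta zeta [N1 H1] [N2 H2].
pose N := maxn N1 N2.
have fN : lip_on (mass_le N) L f by apply: sub_lip_on fL; exact: sub_mass_finite.
have [B fB] := lip_bounded_on L0 fN.
apply: (jump_semigroup_lip t0 L0 fB fN).
  by apply: mass_le_mono H1; exact: leq_maxl.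
by apply: mass_le_mono H2; exact: leq_maxr.
Qed.

(** * The semigroup on Lipschitz functions *)

Definition migration_semigroup t f : config a -> R := extend (T t f).

Local Notation S := migration_semigroup.

Section semigroup_of_lipschitz.
Variables (L : R) (f : config a -> R).
Hypothesis L_ge0 : 0 <= L.
Hypothesis fL : lip_on setT L f.

Let fF : lip_on finite_mass L f. Proof. by apply: sub_lip_on fL. Qed.
Let fN N : lip_on (mass_le N) L f. Proof. by apply: sub_lip_on fL. Qed.

Lemma bounded_on_lip N : exists B, bounded_on (mass_le N) f B.
Proof. exact: lip_bounded_on L_ge0 (@fN N). Qed.

Lemma migration_semigroupE t eta : 0 <= t -> finite_mass eta -> S t f eta = T t f eta.
Proof. by move=> t0; exact: (extendE (jump_semigroup_lip_finite t0 L_ge0 fF)). Qed.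

Lemma migration_semigroup_cvg t eta : 0 <= t ->
  T t f (cut n eta) @[n --> \oo] --> S t f eta.
Proof.
by move=> t0; exact: (extend_cvg (jump_semigroup_lip_finite t0 L_ge0 fF)).
Qed.

Lemma migration_semigroup_lip t : 0 <= t ->
  lip_on setT (L * expR (lip_growth * t)) (S t f).
Proof.
move=> t0; apply: extend_lip; first by rewrite mulr_ge0// expR_ge0.
exact: jump_semigroup_lip_finite.
Qed.

Lemma migration_semigroup_time_le t eta : 0 <= t ->
  `|S t f eta - f eta| <= t * (L * expR (lip_growth * t) * (C * (1 + M) * rnorm eta)).
Proof.
move=> t0.
apply: (@cvgr_to_le _ (\oo : set_system nat) _ R
  (fun n => `|T t f (cut n eta) - f (cut n eta)|)).
  by apply: cvg_norm; apply: cvgB; [exact: migration_semigroup_cvg|exact: lip_cut_cvg fL].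
apply: nearW => n.
have [N HN] := cut_finite_mass n eta; have [B fB] := bounded_on_lip N.
apply: le_trans (jump_semigroup_time_le t0 L_ge0 fB (@fN N) HN) _.
rewrite !ler_wpM2l ?mulr_ge0 ?expR_ge0 ?addr_ge0 ?(ltW C_gt0) ?(ltW M_gt0)//.
exact: rnorm_cut.
Qed.

Lemma migration_semigroupD s t : 0 <= s -> 0 <= t -> S (s + t) f = S s (S t f).
Proof.
move=> s0 t0; apply/funext => eta; rewrite /S /extend; congr (lim (_ @ \oo)).
apply/funext => n; have [N HN] := cut_finite_mass n eta; have [B fB] := bounded_on_lip N.
rewrite (jump_semigroupD (mass_le_rates N) s0 t0 fB HN).
apply: (eq_jump_semigroup (mass_le_rates N) _ _ HN) => xi Hxi.
by rewrite -[RHS]/(S t f xi) migration_semigroupE//; exists N.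
Qed.

Lemma migration_semigroup0 : S 0 f = f.
Proof.
apply/funext => eta; apply/cvg_lim => //; apply: cvg_trans (lip_cut_cvg fL).
apply: near_eq_cvg; apply: nearW => n.
have [N HN] := cut_finite_mass n eta; have [B fB] := bounded_on_lip N.
by rewrite (jump_semigroup0 (mass_le_rates N) fB HN).
Qed.

Lemma migration_semigroup_ge0 t : 0 <= t -> (forall eta, 0 <= f eta) ->
  forall eta, 0 <= S t f eta.
Proof.
move=> t0 f0 eta; apply: (cvgr_to_ge (migration_semigroup_cvg t0)).
apply: nearW => n; have [N HN] := cut_finite_mass n eta.
have [B fB] := bounded_on_lip N.
exact: (jump_semigroup_ge0 (mass_le_rates N) t0 fB).
Qed.

(** For finite configurations this is calculus; the truncations of an infinite one satisfy
    it with integrands bounded uniformly by the linear growth of the generator. *)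
Lemma migration_semigroup_integral t eta : 0 <= t ->
  (@lebesgue_measure R).-integrable `[0, t] (fun s => (Q (S s f) eta)%:E) /\
  (\int[@lebesgue_measure R]_(s in `[0%R, t]) (Q (S s f) eta)%:E =
   (S t f eta - f eta)%:E)%E.
Proof.
move=> t0.
have QS n s : 0 <= s -> Q (S s f) (cut n eta) = Q (T s f) (cut n eta).
  move=> s0; have [N HN] := cut_finite_mass n eta.
  apply: (eq_jump_gen (mass_le_rates N) _ HN) => xi Hxi.
  by rewrite migration_semigroupE//; exists N.
have taylor n : exists K, 0 <= K /\ forall s s', 0 <= s -> 0 <= s' ->
    `|T s' f (cut n eta) - T s f (cut n eta) - (s' - s) * Q (T s f) (cut n eta)|
    <= K * (s' - s) ^+ 2.
  have [N HN] := cut_finite_mass n eta; have [B fB] := bounded_on_lip N.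
  exists (3 * (2 * (C * N%:R) ^+ 2 * B)); split.
    have B0 := bounded_on_ge0 HN fB.
    by rewrite mulr_ge0// mulr_ge0// mulr_ge0 ?sqr_ge0.
  by move=> s s' s0 s0'; exact: (jump_semigroup_taylor (mass_le_rates N) s0 s0' fB HN).
pose I0t : set R := `[0, t]%classic.
have mI : @measurable _ (measurableTypeR R) I0t by exact: measurable_itv.
pose b := L * expR (lip_growth * t) * (C * (1 + M) * rnorm eta).
pose F (n : nat) (s : R) : \bar R := (Q (S s f) (cut n eta))%:E.
have mF n : @measurable_fun _ _ (measurableTypeR R) (\bar R) I0t (F n).
  have [K [K0 ht]] := taylor n.
  apply/measurable_EFinP.
  apply: (eq_measurable_fun (fun s => Q (T s f) (cut n eta))).
    by move=> s; rewrite /I0t inE /= in_itv /= => /andP[s0 _]; rewrite QS.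
  apply: subspace_continuous_measurable_fun => //.
  exact: (taylor_continuous K0 ht).
have cF s : I0t s -> F n s @[n --> \oo] --> (Q (S s f) eta)%:E.
  rewrite /I0t /= in_itv /= => /andP[s0 _]; apply: cvg_EFin; first by exact: nearW.
  apply: (@jump_gen_cut_cvg (L * expR (lip_growth * s))).
    by rewrite mulr_ge0// expR_ge0.
  exact: migration_semigroup_lip.
have bF s n : I0t s -> (`|F n s| <= (cst b%:E : R -> \bar R) s)%E.
  rewrite /I0t /= in_itv /= => /andP[s0 st]; rewrite lee_fin.
  have Ls : 0 <= L * expR (lip_growth * s) by rewrite mulr_ge0// expR_ge0.
  apply: le_trans (@jump_gen_lip_le setT _ _ (cut n eta) (fun _ _ _ => I) Ls
    (migration_semigroup_lip s0) I) _.
  apply: ler_pM => //.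
  - by rewrite !mulr_ge0 ?rnorm_ge0 ?addr_ge0 ?(ltW C_gt0) ?(ltW M_gt0).
  - by rewrite ler_wpM2l// ler_expR ler_wpM2l// lip_growth_ge0.
  by rewrite ler_wpM2l ?rnorm_cut// mulr_ge0 ?addr_ge0 ?(ltW C_gt0) ?(ltW M_gt0).
have ib : (@lebesgue_measure R).-integrable I0t (cst b%:E).
  apply/integrableP; split; first exact: measurable_cst.
  rewrite /= integral_cst//= lebesgue_measure_itv/=.
  by case: ifP => _; rewrite ?mule0 ?ltry// -EFinB -EFinM ltry.
have mQ := emeasurable_fun_cvg _ (fun s => (Q (S s f) eta)%:E) mF cF.
have [||iQ _ cI] := @dominated_convergence _ (measurableTypeR R) R (@lebesgue_measure R)
  I0t mI F (fun s => (Q (S s f) eta)%:E) (cst b%:E) mF mQ _ ib _.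
- by apply: aeW => s; exact: cF.
- by apply: aeW => s n; exact: bF.
split=> //.
have IF n : (\int[@lebesgue_measure R]_(s in `[0%R, t]) F n s =
    (T t f (cut n eta) - f (cut n eta))%:E)%E.
  have [K [K0 ht]] := taylor n.
  have [N HN] := cut_finite_mass n eta; have [B fB] := bounded_on_lip N.
  rewrite -(jump_semigroup0 (mass_le_rates N) fB HN) -(integral_taylor K0 ht t0).
  by apply: eq_integral => s; rewrite inE /= in_itv /= => /andP[s0 _]; rewrite /F QS.
have cL : (T t f (cut n eta) - f (cut n eta))%:E @[n --> \oo] --> (S t f eta - f eta)%:E.
  apply: cvg_EFin; first exact: nearW.
  by apply: cvgB; [exact: migration_semigroup_cvg|exact: lip_cut_cvg fL].
apply: (cvg_unique _ cI _) => //.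
by apply: cvg_trans cL; apply: near_eq_cvg; apply: nearW => n; exact: esym (IF n).
Qed.

End semigroup_of_lipschitz.
(** * The countable chain of finite configurations *)

(** Beyond finitely many sites the remaining mass is at most 1/2, hence zero. *)
Lemma finite_mass_cut eta : finite_mass eta -> exists n, cut n eta = eta.
Proof.
move=> [N HN].
have [J [Jfin _ Jt]] := @esum_small_tail R X setT (fun x => (val eta x)%:R) 2^-1
  ltac:(by rewrite invr_gt0) (fun _ _ => ler0n _ _) (le_lt_trans HN (ltry _)).
exists (\max_(x <- fset_set J) choice.pickle x).+1; apply: val_inj; apply/funext => x /=.
rewrite /cut_fun ltnS; case: ifPn => // xJ.
have nJ : ~ J x.
  move=> Jx; move/negP: xJ; apply; apply: (leq_bigmax_seq x) => //.
  by rewrite in_fset_set// inE.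
have : ((val eta x)%:R%:E <= 2^-1%:E :> \bar R)%E.
  apply: le_trans Jt.
  by apply: (@le_esum_term _ _ (setT `&` ~` J) (fun x => (val eta x)%:R)).
rewrite lee_fin; case E : (val eta x) => [|k]; first by move=> _; exact: esym E.
rewrite leNgt => /negP[]; apply: (@lt_le_trans _ _ 1); last by rewrite ler1n.
by rewrite invf_lt1// ltr1n.
Qed.

Definition finite_moved (eta : finite_config a) (i : X * X * nat) : finite_config a :=
  let: exist N etaN := cid (finite_config_mass eta) in
  exist _ (moved (val eta) i) (mass_le_finite (mass_le_moved i etaN)).

Lemma val_finite_moved (eta : finite_config a) i : val (finite_moved eta i) = moved (val eta) i.
Proof. by rewrite /finite_moved; case: cid. Qed.

Definition finite_rate (eta : finite_config a) (i : X * X * nat) : R := rate (val eta) i.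

Definition finite_mass_le N : set (finite_config a) := [set eta : finite_config a | mass_le N (val eta)].

Lemma finite_rates N :
  bounded_rates transitions finite_rate finite_moved (finite_mass_le N) (C * N%:R).
Proof.
have [r0 lam0 Acl rl] := mass_le_rates N; split=> //.
- by move=> eta i; exact: r0.
- by move=> eta i etaN Di; rewrite /finite_mass_le /= val_finite_moved; exact: Acl.
- by move=> eta etaN; exact: rl.
Qed.

Lemma finite_exhausts (eta : finite_config a) : exists N, finite_mass_le N eta.
Proof. exact: finite_config_mass. Qed.

(** Finitely many occupation numbers determine a configuration of finite mass, since its
    occupied sites are finitely many. *)
Lemma finite_config_code : exists code : finite_config a -> nat, injective code.
Proof.
have H (eta : finite_config a) : {n | cut n (val eta) = val eta}.
  by apply: cid; apply: finite_mass_cut; exact: finite_config_mass.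
pose occ n (eta : finite_config a) : seq nat :=
  [seq (if @choice.unpickle X k is Some x then val (val eta) x else 0%N) | k <- iota 0 n].
exists (fun eta : finite_config a => choice.pickle (occ (sval (H eta)) eta)) => eta zeta.
move=> /(pcan_inj choice.pickleK) E; apply: val_inj; apply: val_inj; apply/funext => x.
have En : sval (H eta) = sval (H zeta).
  by have := congr1 size E; rewrite !size_map !size_iota.
move: E (svalP (H eta)) (svalP (H zeta)); rewrite En.
move: (sval (H zeta)) => n E He Hz.
have out (xi : finite_config a) : cut n (val xi) = val xi ->
    (n <= choice.pickle x)%N -> val (val xi) x = 0%N.
  by move=> <- nx; rewrite /= /cut_fun ltnNge nx.
have [xn|nx] := ltnP (choice.pickle x) n; last by rewrite !out.
have := congr1 (fun s => nth 0%N s (choice.pickle x)) E.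
by rewrite !(nth_map 0%N) ?size_iota// nth_iota// add0n choice.pickleK.
Qed.

Lemma jump_intensity_rate (eta zeta : finite_config a) :
  jump_intensity transitions finite_rate finite_moved eta zeta = jump_rate p g eta zeta.
Proof.
rewrite /jump_intensity /jump_rate; congr esum.
apply/seteqP; split => i /= [i0 mi]; split => //; first by rewrite -mi val_finite_moved.
by apply: val_inj; rewrite val_finite_moved.
Qed.

Lemma migration_semigroup_finite L f t (eta : finite_config a) : 0 <= L -> lip_on setT L f ->
  0 <= t ->
  S t f (val eta) = jump_semigroup transitions finite_rate finite_moved t (f \o val) eta.
Proof.
move=> L0 fL t0; rewrite (migration_semigroupE L0 fL t0); last exact: finite_config_mass.
exact: (jump_semigroup_comp transitions rate val_finite_moved).
Qed.

Lemma migration_semigroup_linear t (c : R) f f' L L' : 0 <= t -> 0 <= L -> 0 <= L' ->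
  lip_on setT L f -> lip_on setT L' f' ->
  S t (fun eta => c * f eta + f' eta) = (fun eta => c * S t f eta + S t f' eta).
Proof.
move=> t0 L0 L0' fL fL'; apply/funext => eta; apply/cvg_lim => //.
have : c * T t f (cut n eta) + T t f' (cut n eta) @[n --> \oo] --> c * S t f eta + S t f' eta.
  apply: cvgD; last exact: (migration_semigroup_cvg L0' fL' t0).
  by apply: cvgM; [exact: cvg_cst|exact: (migration_semigroup_cvg L0 fL t0)].
apply: cvg_trans; apply: near_eq_cvg; apply: nearW => n.
have [N HN] := cut_finite_mass n eta.
have [B fB] := bounded_on_lip L0 fL N; have [B' fB'] := bounded_on_lip L0' fL' N.
by rewrite (jump_semigroup_linear (mass_le_rates N) _ t0 fB fB' HN).
Qed.

(** By the semigroup property this is the estimate [migration_semigroup_time_le] for small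
    times, applied to [S t f]. *)
Lemma migration_semigroup_right_cts L f t eta : 0 <= L -> lip_on setT L f -> 0 <= t ->
  S s f eta @[s --> t^'+] --> S t f eta.
Proof.
move=> L0 fL t0.
set L' := L * expR (lip_growth * t).
have L'0 : 0 <= L' by rewrite mulr_ge0// expR_ge0.
pose K := L' * expR lip_growth * (C * (1 + M) * rnorm eta).
have K0 : 0 <= K.
  by rewrite !mulr_ge0 ?expR_ge0 ?rnorm_ge0 ?addr_ge0 ?(ltW C_gt0) ?(ltW M_gt0).
apply/cvgrPdist_le => e e0; near=> s.
have ts : t < s by near: s; exact: nbhs_right_gt.
have s1 : s <= t + 1 by near: s; apply: nbhs_right_le; rewrite ltrDl.
have se : s <= t + e / (K + 1) by near: s; apply: nbhs_right_le; rewrite ltrDl divr_gt0// ltr_wpDl.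
have st0 : 0 <= s - t by rewrite subr_ge0 ltW.
rewrite distrC -[s](subrK t) (migration_semigroupD L0 fL st0 t0).
have := migration_semigroup_time_le L'0 (migration_semigroup_lip L0 fL t0) eta st0.
move=> /le_trans; apply; apply: (@le_trans _ _ ((s - t) * K)).
  rewrite ler_wpM2l// /K ler_wpM2r//.
    by rewrite !mulr_ge0 ?rnorm_ge0 ?addr_ge0 ?(ltW C_gt0) ?(ltW M_gt0).
  by rewrite ler_wpM2l// ler_expR ler_piMr ?lip_growth_ge0// lerBlDl.
have : (s - t) * (K + 1) <= e by rewrite -ler_pdivlMr ?ltr_wpDl// lerBlDl.
by apply: le_trans; rewrite ler_wpM2l// lerDl.
Unshelve. all: by end_near. Qed.

End rates.
Theorem theorem2p2 (R : realType) (X : countType)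
  (X_infinite : infinite_set [set: X])
  (p : X -> X -> R)
  (p_trans : transition_probability p)
  (p_irr : irreducible p)
  (p_col : (ereal_sup [set \esum_(x in setT) (p x y)%:E | y in [set: X]] < +oo)%E)
  (g : nat -> nat -> nat -> R)
  (g_ge0 : forall k alpha beta, 0 <= g k alpha beta)
  (g_0 : forall alpha beta, g 0%N alpha beta = 0)
  (g_vanish : forall k alpha beta,
     (alpha < k)%N \/ alpha = 0%N -> g k alpha beta = 0)
  (a : X -> {posnum R}) (M : R) (M_gt0 : 0 < M)
  (a_bound : forall x : X,
     (\esum_(y in setT) (p x y * (a y)%:num)%:E
      + \esum_(y in setT) ((a y)%:num * p y x)%:E <= (M * (a x)%:num)%:E)%E)
  (a_summable : (\esum_(x in setT) ((a x)%:num)%:E < +oo)%E)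
  (C : R) (C_gt0 : 0 < C)
  (g_lip : forall alpha beta gamma delta : nat,
     \sum_(1 <= k < (maxn alpha gamma).+1)
        k%:R * `|g k alpha beta - g k gamma delta|
     <= C * (`|alpha%:R - gamma%:R| + `|beta%:R - delta%:R|)) :
  exists (S : R -> (config a -> R) -> (config a -> R)) (c : R),
    markov_semigroup S /\ 0 < c /\
    [/\ forall f t, f \in LL a -> 0 <= t ->
          S t f \in LL a /\
          (forall L, lipschitz_constant f L ->
             lipschitz_constant (S t f) (L * expR (c * t))),
        forall f t eta, f \in LL a -> 0 <= t ->
          (@lebesgue_measure R).-integrable `[0, t]
             (fun s => (generator p g (S s f) eta)%:E) /\
          S t f eta = f eta +
            \int[@lebesgue_measure R]_(s in `[0, t]) generator p g (S s f) eta
      & (exists P : R -> finite_config a -> finite_config a -> R,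
           transition_function P /\ has_jump_rates P (jump_rate p g)) /\
        forall f t (eta : finite_config a), f \in LL a -> 0 <= t ->
        forall (d : measure_display) (Omega : measurableType d)
          (Pr : probability Omega R) (eta_ : R -> Omega -> finite_config a),
          markov_jump_process (jump_rate p g) eta Pr eta_ ->
          (S t f (val eta))%:E = ('E_Pr[fun w => f (val (eta_ t w))])%E ].
Proof.
(* the maximum with 0 makes the bound on the column sums visibly nonnegative *)
pose mp : R := Num.max (fine (ereal_sup [set \esum_(x in setT) (p x y)%:E | y in [set: X]])) 0.
have mp_ge0 : 0 <= mp by rewrite le_max lexx orbT.
have mp_col y : (\esum_(x in setT) (p x y)%:E <= mp%:E)%E.
  have le_sup : (\esum_(x in setT) (p x y)%:E <=
      ereal_sup [set \esum_(x in setT) (p x y)%:E | y in [set: X]])%E.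
    by apply: ereal_sup_ubound; exists y.
  apply: (le_trans le_sup); rewrite /mp EFin_max le_max fineK ?lexx//.
  rewrite ge0_fin_numE//; apply: le_trans le_sup; apply: esum_ge0 => x _.
  by rewrite lee_fin p_trans.1.
pose c := lip_growth M mp C.
pose S := migration_semigroup (a := a) p g.
have LLP f : f \in LL a -> exists L, 0 <= L /\ lip_on setT L f.
  by rewrite inE => -[L /lipschitz_constantE[/ltW L0 fL]]; exists L.
have S_lip f L t : lipschitz_constant f L -> 0 <= t ->
    lipschitz_constant (S t f) (L * expR (c * t)).
  move=> /lipschitz_constantE[L0 fL] t0; apply/lipschitz_constantE; split.
    by rewrite mulr_gt0// expR_gt0.
  exact: (migration_semigroup_lip p_trans mp_ge0 mp_col g_ge0 g_vanish M_gt0 a_bound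
    a_summable C_gt0 g_lip (ltW L0) fL t0).
have S_LL f t : f \in LL a -> 0 <= t -> S t f \in LL a.
  by rewrite !inE => -[L fL] t0; exists (L * expR (c * t)); exact: S_lip.
exists S, c; split; [|split].
- split.
  + by move=> t f t0 fLL; exact: S_LL.
  + move=> t u f h t0 /LLP[L [L0 fL]] /LLP[L' [L0' hL]].
    exact: (migration_semigroup_linear p_trans mp_ge0 mp_col g_ge0 g_vanish M_gt0 a_bound
      a_summable C_gt0 g_lip u t0 L0 L0' fL hL).
  + move=> f /LLP[L [L0 fL]].
    exact: (migration_semigroup0 p_trans g_ge0 g_vanish a_summable C_gt0 g_lip L0 fL).
  + move=> s t f s0 t0 /LLP[L [L0 fL]].
    exact: (migration_semigroupD p_trans mp_ge0 mp_col g_ge0 g_vanish M_gt0 a_bound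
      a_summable C_gt0 g_lip L0 fL s0 t0).
  + move=> t t0; apply/funext => eta; apply/cvg_lim => //.
    under eq_fun do rewrite jump_semigroup_cst.
    exact: cvg_cst.
  + move=> t f t0 /LLP[L [L0 fL]].
    exact: (migration_semigroup_ge0 p_trans mp_ge0 mp_col g_ge0 g_vanish M_gt0 a_bound
      a_summable C_gt0 g_lip L0 fL t0).
  + move=> t f eta t0 /LLP[L [L0 fL]].
    exact: (migration_semigroup_right_cts p_trans mp_ge0 mp_col g_ge0 g_vanish M_gt0 a_bound
      a_summable C_gt0 g_lip L0 fL t0).
- by rewrite /c /lip_growth mulr_gt0// ltr_wpDr// addr_gt0.
split.
- by move=> f t fLL t0; split; [exact: S_LL|move=> L fL; exact: S_lip].
- move=> f t eta /LLP[L [L0 fL]] t0.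
  have [iS IS] := migration_semigroup_integral p_trans mp_ge0 mp_col g_ge0 g_vanish M_gt0
    a_bound a_summable C_gt0 g_lip L0 fL eta t0.
  split; first exact: iS.
  rewrite /Rintegral; under eq_integral do rewrite generatorE.
  by rewrite IS /= addrC subrK.
have [code code_inj] := finite_config_code a.
have rates := finite_rates a p_trans g_ge0 g_vanish C_gt0 g_lip.
have exhausts := @finite_exhausts R X a.
(* the rates between finite configurations, as those of an abstract jump chain *)
have qE : jump_intensity transitions (finite_rate p g) (finite_moved (a := a)) = jump_rate p g.
  by apply/funext => eta; apply/funext => zeta; rewrite jump_intensity_rate.
split.
  exists (jump_chain transitions (finite_rate p g) (finite_moved (a := a))); split.
    exact: (jump_chain_transition code_inj rates exhausts).
  rewrite -qE; exact: (jump_chain_rates rates exhausts).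
move=> f t eta /LLP[L [L0 fL]] t0 d Omega Pr Y.
rewrite -qE => HY.
have fb : locally_bounded (finite_mass_le (a := a)) (f \o val).
  move=> N; have [B fB] := bounded_on_lip a_summable L0 fL N.
  by exists B => xi Hxi; exact: fB.
rewrite (jump_process_expectation code_inj rates exhausts HY t0 fb); congr EFin.
exact: (migration_semigroup_finite p_trans mp_ge0 mp_col g_ge0 g_vanish M_gt0 a_bound
  a_summable C_gt0 g_lip eta L0 fL t0).
Qed.
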